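(* Let $\mathcal{H}$ be a hypergraph on a finite set $V$ and let $f,g:\mathcal{H}\to\mathbb{R}$ be two real valued functions. Then for every integer $p\ge 0$, $$d_B\big(V^f_p,V^g_p\big)\le \|f-g\|_\infty,\qquad \|f-g\|_\infty=\sup_{\sigma\in\mathcal{H}}|f(\sigma)-g(\sigma)|.$$
   Context: Fix a field $k$. Homology of graded subgroups. A graded subgroup $D_*$ of a chain complex $(C_*,\partial)$ of $k$-vector spaces is a family of subspaces $D_p\subseteq C_p$. Its supremum complex is the subcomplex $S_p(D_* )=D_p+\partial D_{p+1}$. Put $H_p^{\sup}(D_*;C_* )=H_p(S_*(D_* ))$, and for graded subgroups $E_*\subseteq D_*$ put $H^{\sup}_p(D_*,E_*;C_* )=H_p(S_*(D_* )/S_*(E_* ))$. Hypergraphs. A hypergraph $\mathcal{H}$ on a finite set $V$ is a set of non-empty subsets of $V$ (hyperedges). $K_{\mathcal{H}}=\{\tau\neq\varnothing:\tau\subseteq\sigma\text{ for some }\sigma\in\mathcal{H}\}$ is a simplicial complex, and $\Delta_*(K_{\mathcal{H}})$ is its (oriented) simplicial chain complex over $k$. For $\mathcal{H}'\subseteq\mathcal{H}$, $\Delta_*(\mathcal{H}')$ is the graded subgroup of $\Delta_*(K_{\mathcal{H}})$ spanned by the hyperedges of $\mathcal{H}'$ (a hyperedge with $p+1$ elements lies in degree $p$). Put $H_p(\mathcal{H}')=H_p^{\sup}(\Delta_*(\mathcal{H}');\Delta_*(K_{\mathcal{H}}))$ and $H_p(\mathcal{H},\mathcal{H}')=H_p^{\sup}(\Delta_*(\mathcal{H}),\Delta_*(\mathcal{H}');\Delta_*(K_{\mathcal{H}}))$.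 Extended persistence modules. Let $\mathbb{R}^o$ be $\mathbb{R}$ with reversed order, the element corresponding to $b\in\mathbb{R}$ written $\overline{b}$, and let $\mathbb{E}=\mathbb{R}\cup\{\infty\}\cup\mathbb{R}^o$ with $s<\infty<\overline{t}$ for all $s,t\in\mathbb{R}$. An extended persistence module is a functor from the poset $\mathbb{E}$ to finite dimensional $k$-vector spaces. For $f:\mathcal{H}\to\mathbb{R}$ and $a\in\mathbb{R}$ let $\mathcal{H}^f_a=f^{-1}((-\infty,a])$, $\mathcal{H}^f_{\overline{a}}=f^{-1}([a,+\infty))$. The extended persistence module $V^f_p$ is defined by $V^f_p(a)=H_p(\mathcal{H}^f_a)$, $V^f_p(\infty)=H_p(\mathcal{H})$, $V^f_p(\overline{a})=H_p(\mathcal{H},\mathcal{H}^f_{\overline{a}})$, with maps induced by inclusions (and the corresponding projections of quotient complexes). Diagrams. For an interval $I\subseteq\mathbb{E}$, the interval module $k_I$ is $k$ on $I$ and $0$ elsewhere, with identity maps between nonzero spaces. An extended persistence module is decomposable if it is isomorphic to a direct sum of finitely many interval modules, none of which has $\infty$ as an endpoint (such a decomposition is unique). For decomposable $V$ define multisets (counting multiplicity, regardless of whether endpoints are included): $\mathrm{Ord}(V)$ on $\mathbb{R}\times\mathbb{R}$ has a point $(a,a')$ for each interval with endpoints $a\le a'$ in $\mathbb{R}$; $\mathrm{Rel}(V)$ on $\mathbb{R}^o\times\mathbb{R}^o$ has a point $(\overline{b},\overline{b'})$ for each interval with endpoints $\overline{b}\le\overline{b'}$ in $\mathbb{R}^o$;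 $\mathrm{Ext}(V)$ on $\mathbb{R}\times\mathbb{R}^o$ has a point $(a,\overline{b})$ for each interval with endpoints $a\in\mathbb{R}$, $\overline{b}\in\mathbb{R}^o$. On each plane use $d((x,y),(z,w))=\max(|x-z|,|y-w|)$ (elements of $\mathbb{R}^o$ being identified with real numbers). Bottleneck distance. A partial matching between multisets $A,B$ is a bijection between sub-multisets $A'\subset A$, $B'\subset B$; it is perfect if $A'=A$, $B'=B$. For $\delta>0$, a $\delta$-matching between $V,W$ is a triple $(\phi_O,\phi_R,\phi_E)$ with $\phi_O$ a partial matching between $\mathrm{Ord}(V),\mathrm{Ord}(W)$, $\phi_R$ a partial matching between $\mathrm{Rel}(V),\mathrm{Rel}(W)$, $\phi_E$ a perfect matching between $\mathrm{Ext}(V),\mathrm{Ext}(W)$, such that all matched pairs are at distance at most $\delta$ and all unmatched points are at distance at most $\delta$ from the diagonal of their plane. $d_B(V,W)=\inf\{\delta>0: V,W\text{ are }\delta\text{-matched}\}$. *)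

(* Defs.v *)
From HB Require Import structures.
From mathcomp Require Import all_boot all_order all_algebra.
From mathcomp Require Import boolp classical_sets reals constructive_ereal ereal.

Set Implicit Arguments.
Unset Strict Implicit.
Unset Printing Implicit Defensive.

Import Order.TTheory GRing.Theory Num.Theory.
Local Open Scope ring_scope.

Section Quotient.
Variable k : fieldType.
Implicit Types U V : vectType k.

(* The library has no quotient of a vectType by a subspace.  [quot W] is the
   usual model: a fixed linear complement of W, with the projection along W.
   [quot_piK], [limg_quot_pi] and [lker_quot_pi] characterize it as V / W. *)
Definition quot V (W : {vspace V}) : vectType k := subvs_of (W^C)%VS.

Definition quot_repr V (W : {vspace V}) : 'Hom(quot W, V) := linfun vsval.

Definition quot_pi V (W : {vspace V}) : 'Hom(V, quot W) :=
  (linfun (vsproj (W^C)%VS) \o daddv_pi (W^C)%VS W)%VF.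

Definition quot_map U V (W : {vspace U}) (W' : {vspace V}) (f : 'Hom(U, V)) :
  'Hom(quot W, quot W') := (quot_pi W' \o f \o quot_repr W)%VF.

Lemma quot_reprE V (W : {vspace V}) (x : quot W) : quot_repr W x = vsval x.
Proof. by rewrite lfunE. Qed.

Lemma quot_piE V (W : {vspace V}) v :
  vsval (quot_pi W v) = daddv_pi (W^C)%VS W v.
Proof. by rewrite !lfunE /= lfunE /= vsprojK // memv_pi. Qed.

Lemma quot_piK V (W : {vspace V}) : cancel (quot_repr W) (quot_pi W).
Proof.
move=> x; apply: val_inj; rewrite /= quot_piE quot_reprE daddv_pi_id //.
  by rewrite capvC capv_compl.
exact: subvsP.
Qed.

Lemma limg_quot_pi V (W : {vspace V}) : limg (quot_pi W) = fullv.
Proof.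
apply/eqP; rewrite eqEsubv subvf; apply/subvP=> x _.
by rewrite -(quot_piK x) memv_img ?memvf.
Qed.

Lemma quot_pi_repr V (W : {vspace V}) v : v - quot_repr W (quot_pi W v) \in W.
Proof.
have d0 : ((W^C) :&: W = 0)%VS by rewrite capvC capv_compl.
have vW : v \in (W^C + W)%VS by rewrite addvC addv_complf memvf.
rewrite quot_reprE quot_piE -{1}(daddv_pi_add d0 vW) addrAC subrr add0r.
exact: memv_pi.
Qed.

Lemma lker_quot_pi V (W : {vspace V}) : lker (quot_pi W) = W.
Proof.
have d0 : ((W^C) :&: W = 0)%VS by rewrite capvC capv_compl.
apply/eqP; rewrite eqEsubv; apply/andP; split; apply/subvP=> v.
  by rewrite memv_ker => /eqP v0; have := quot_pi_repr W v;
     rewrite v0 linear0 subr0.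
move=> vW; rewrite memv_ker; apply/eqP/val_inj; rewrite /= quot_piE.
have vWC : v \in (W^C + W)%VS by rewrite addvC addv_complf memvf.
have := daddv_pi_add d0 vWC; rewrite (daddv_pi_id (capv_compl W) vW) => vE.
by apply: (addIr v); rewrite vE add0r.
Qed.

Lemma quot_piP V (W : {vspace V}) u v :
  u - v \in W -> quot_pi W u = quot_pi W v.
Proof.
by rewrite -{1}(lker_quot_pi W) memv_ker linearB subr_eq0 => /eqP.
Qed.

Lemma quot_ind V (W : {vspace V}) (P : quot W -> Prop) :
  (forall v, P (quot_pi W v)) -> forall x, P x.
Proof. by move=> Ppi x; rewrite -(quot_piK x). Qed.

Lemma quot_mapE U V (W : {vspace U}) (W' : {vspace V}) (f : 'Hom(U, V)) u :
  (f @: W <= W')%VS -> quot_map W W' f (quot_pi W u) = quot_pi W' (f u).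
Proof.
move=> fW; rewrite /quot_map 2!comp_lfunE; apply: quot_piP.
rewrite -linearB -opprB linearN rpredN.
by apply: (subvP fW); rewrite memv_img // quot_pi_repr.
Qed.

(* A restricted to B, as a subspace of B *)
Definition vs_in V (B A : {vspace V}) : {vspace subvs_of B} :=
  (linfun vsval @^-1: A)%VS.

Lemma mem_vs_in V (B A : {vspace V}) (x : subvs_of B) :
  (x \in vs_in B A) = (vsval x \in A).
Proof. by rewrite -memv_preim lfunE. Qed.

Definition sub_map U V (A : {vspace U}) (B : {vspace V}) (f : 'Hom(U, V)) :
  'Hom(subvs_of A, subvs_of B) :=
  (linfun (vsproj B) \o f \o linfun vsval)%VF.

Lemma sub_mapE U V (A : {vspace U}) (B : {vspace V}) (f : 'Hom(U, V))
    (x : subvs_of A) :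
  f (vsval x) \in B -> vsval (sub_map A B f x) = f (vsval x).
Proof. by move=> fx; rewrite /sub_map !comp_lfunE !lfunE /= vsprojK. Qed.

End Quotient.

Section Complex.
Variable k : fieldType.

Record complex := Complex {
  ch :> nat -> vectType k;
  bd : forall p, 'Hom(ch p.+1, ch p);
  bd_bd : forall p x, bd p (bd p.+1 x) = 0 }.

(* the differential leaving degree 0 is zero *)
Definition cycles (C : complex) (p : nat) : {vspace C p} :=
  match p with 0%N => fullv | q.+1 => lker (bd C q) end.

Definition boundaries (C : complex) (p : nat) : {vspace C p} :=
  limg (bd C p).

Definition homology (C : complex) (p : nat) : vectType k :=
  quot (vs_in (cycles C p) (boundaries C p)).

Definition homology_map (C D : complex) (f : forall p, 'Hom(C p, D p)) p :
  'Hom(homology C p, homology D p) :=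
  quot_map _ _ (sub_map (cycles C p) (cycles D p) (f p)).

Definition chain_map (C D : complex) (f : forall p, 'Hom(C p, D p)) :=
  forall p x, f p (bd C p x) = bd D p (f p.+1 x).

Lemma chain_map_comp (C D E : complex) (f : forall p, 'Hom(C p, D p))
    (g : forall p, 'Hom(D p, E p)) :
  chain_map f -> chain_map g -> chain_map (fun p => (g p \o f p)%VF).
Proof. by move=> cf cg p x; rewrite 2!comp_lfunE cf cg. Qed.

Lemma chain_map_cycles (C D : complex) (f : forall p, 'Hom(C p, D p)) p x :
  chain_map f -> x \in cycles C p -> f p x \in cycles D p.
Proof.
case: p x => [|p] x cf; first by move=> _; exact: memvf.
by rewrite !memv_ker -cf => /eqP->; rewrite linear0.
Qed.

Lemma homology_mapE (C D : complex) (f : forall p, 'Hom(C p, D p)) p x :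
  chain_map f ->
  homology_map f p (quot_pi _ x) =
  quot_pi _ (sub_map (cycles C p) (cycles D p) (f p) x).
Proof.
move=> cf; apply: quot_mapE; apply/subvP=> _ /memv_imgP[y yB ->].
rewrite mem_vs_in sub_mapE ?(chain_map_cycles cf) ?subvsP //.
move: yB; rewrite mem_vs_in => /memv_imgP[z _ ->].
by rewrite cf memv_img ?memvf.
Qed.

Lemma homology_map_id (C : complex) (f : forall p, 'Hom(C p, C p)) p :
  (forall p x, f p x = x) -> homology_map f p = \1%VF.
Proof.
move=> f1; apply/lfunP; apply: quot_ind => x.
rewrite homology_mapE ?id_lfunE; last by move=> q y; rewrite !f1.
by congr (quot_pi _ _); apply: val_inj; rewrite /= sub_mapE f1 // subvsP.
Qed.

Lemma homology_map_comp (C D E : complex) (f : forall p, 'Hom(C p, D p))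
    (g : forall p, 'Hom(D p, E p)) (h : forall p, 'Hom(C p, E p)) p :
  chain_map f -> chain_map g -> (forall p x, h p x = g p (f p x)) ->
  homology_map h p = (homology_map g p \o homology_map f p)%VF.
Proof.
move=> cf cg hE; apply/lfunP; apply: quot_ind => x.
have ch : chain_map h by move=> q y; rewrite !hE cf cg.
rewrite comp_lfunE !homology_mapE //; congr (quot_pi _ _); apply: val_inj.
have fx : f p (vsval x) \in cycles D p.
  by rewrite (chain_map_cycles cf) ?subvsP.
rewrite /= !sub_mapE ?hE //; last exact: (chain_map_cycles cg).
exact: (chain_map_cycles cg).
Qed.

Section SubQuotient.
Variables (C : complex) (U : forall p, {vspace C p}).
Hypothesis bdU : forall p, (bd C p @: U p.+1 <= U p)%VS.

Lemma bd_stable p x : x \in U p.+1 -> bd C p x \in U p.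
Proof. by move=> xU; apply: (subvP (bdU p)); rewrite memv_img. Qed.

Fact subcomplex_bd_bd p (x : subvs_of (U p.+2)) :
  sub_map (U p.+1) (U p) (bd C p) (sub_map (U p.+2) (U p.+1) (bd C p.+1) x) = 0.
Proof.
have ux := bd_stable (subvsP x).
by apply: val_inj; rewrite /= !sub_mapE ?bd_bd ?mem0v.
Qed.

Definition subcomplex : complex :=
  {| ch := fun p => subvs_of (U p); bd_bd := subcomplex_bd_bd |}.

Fact quotcomplex_bd_bd p (x : quot (U p.+2)) :
  quot_map (U p.+1) (U p) (bd C p) (quot_map (U p.+2) (U p.+1) (bd C p.+1) x)
  = 0.
Proof. by elim/quot_ind: x => x; rewrite !quot_mapE // bd_bd linear0. Qed.

Definition quotcomplex : complex :=
  {| ch := fun p => quot (U p); bd_bd := quotcomplex_bd_bd |}.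

End SubQuotient.

Section Supremum.
Variable C : complex.
Implicit Types D E : forall p, {vspace C p}.

Definition supS D p : {vspace C p} := (D p + bd C p @: D p.+1)%VS.

Fact supS_stable D p : (bd C p @: supS D p.+1 <= supS D p)%VS.
Proof.
rewrite /supS limgD subv_add addvSr /= -limg_comp.
apply/subvP=> _ /memv_imgP[x _ ->]; rewrite comp_lfunE bd_bd; exact: mem0v.
Qed.

Definition supcomplex D : complex := subcomplex (supS_stable D).

Fact relS_stable D E p :
  (bd (supcomplex D) p @: vs_in (supS D p.+1) (supS E p.+1)
   <= vs_in (supS D p) (supS E p))%VS.
Proof.
apply/subvP=> _ /memv_imgP[x xE ->]; rewrite mem_vs_in in xE.
rewrite mem_vs_in sub_mapE; first exact: bd_stable (supS_stable E) _ _ xE.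
exact: bd_stable (supS_stable D) _ _ (subvsP x).
Qed.

(* S(D) / S(E), for E contained in D *)
Definition supcomplex_rel D E : complex := quotcomplex (relS_stable D E).

Definition supcomplex_incl D D' p : 'Hom(supcomplex D p, supcomplex D' p) :=
  sub_map (supS D p) (supS D' p) \1.

Definition supcomplex_proj D E p : 'Hom(supcomplex D p, supcomplex_rel D E p) :=
  quot_pi (vs_in (supS D p) (supS E p)).

Definition supcomplex_rel_map D E D' E' p :
  'Hom(supcomplex_rel D E p, supcomplex_rel D' E' p) :=
  quot_map (vs_in (supS D p) (supS E p)) (vs_in (supS D' p) (supS E' p))
    (supcomplex_incl D D' p).

Lemma supSS D D' p : (forall q, (D q <= D' q)%VS) -> (supS D p <= supS D' p)%VS.
Proof. by move=> s; rewrite addvS ?limgS. Qed.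

Lemma supcomplex_inclE D D' p x : (forall q, (D q <= D' q)%VS) ->
  vsval (supcomplex_incl D D' p x) = vsval x.
Proof.
move=> s; rewrite sub_mapE id_lfunE //.
exact: subvP (supSS p s) _ (subvsP x).
Qed.

Lemma supcomplex_incl_id D p x : supcomplex_incl D D p x = x.
Proof. by apply: val_inj; rewrite /= supcomplex_inclE. Qed.

Lemma supcomplex_incl_comp D D' D'' p x :
  (forall q, (D q <= D' q)%VS) -> (forall q, (D' q <= D'' q)%VS) ->
  supcomplex_incl D D'' p x =
  supcomplex_incl D' D'' p (supcomplex_incl D D' p x).
Proof.
move=> s t; apply: val_inj; rewrite /= !supcomplex_inclE // => q.
exact: subv_trans (s q) (t q).
Qed.

Lemma supcomplex_bdE D p (x : supcomplex D p.+1) :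
  vsval (bd (supcomplex D) p x) = bd C p (vsval x).
Proof.
by rewrite sub_mapE //; exact: bd_stable (supS_stable D) _ _ (subvsP x).
Qed.

Lemma supcomplex_incl_chain D D' : (forall q, (D q <= D' q)%VS) ->
  chain_map (supcomplex_incl D D').
Proof.
move=> s p x; apply: val_inj; rewrite /= supcomplex_inclE //.
by rewrite !supcomplex_bdE supcomplex_inclE.
Qed.

Lemma supcomplex_proj_chain D E : chain_map (supcomplex_proj D E).
Proof. by move=> p x; rewrite /= quot_mapE // relS_stable. Qed.

Lemma supcomplex_rel_mapE D E D' E' p x :
  (forall q, (D q <= D' q)%VS) -> (forall q, (E q <= E' q)%VS) ->
  supcomplex_rel_map D E D' E' p (supcomplex_proj D E p x) =
  supcomplex_proj D' E' p (supcomplex_incl D D' p x).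
Proof.
move=> s t; apply: quot_mapE; apply/subvP=> _ /memv_imgP[y yE ->].
rewrite mem_vs_in supcomplex_inclE //; apply: subvP (supSS p t) _ _.
by rewrite -mem_vs_in.
Qed.

Lemma supcomplex_rel_map_chain D E D' E' :
  (forall q, (D q <= D' q)%VS) -> (forall q, (E q <= E' q)%VS) ->
  chain_map (supcomplex_rel_map D E D' E').
Proof.
move=> s t p; apply: quot_ind => x.
rewrite -[quot_pi _ x]/(supcomplex_proj D E p.+1 x).
rewrite -supcomplex_proj_chain !supcomplex_rel_mapE //.
by rewrite -supcomplex_proj_chain supcomplex_incl_chain.
Qed.

End Supremum.
End Complex.

Section Hypergraph.
Variables (k : fieldType) (V : finType).
Implicit Types H K : {set {set V}}.

Definition is_hypergraph H : Prop := finset.set0 \notin H.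

Definition assoc_complex H : {set {set V}} :=
  [set t : {set V} | (t != finset.set0) && [exists s in H, t \subset s]]%SET.

Definition simplex K (p : nat) :=
  {s : {set V} | (s \in K) && (#|s| == p.+1)}.

Definition simp_chain K p : vectType k := {ffun simplex K p -> k^o}.

(* the basis element of a p-simplex s (zero if s is not a p-simplex of K) *)
Definition simp_basis K p (s : {set V}) : simp_chain K p :=
  [ffun t : simplex K p => ((val t == s)%:R : k^o)].

(* the simplices are oriented by the enumeration order of V *)
Definition vert_pos (s : {set V}) (v : V) : nat :=
  #|[set u in s | (enum_rank u < enum_rank v)%N]%SET|.

Definition simp_bd_fun K p (c : simp_chain K p.+1) : simp_chain K p :=
  \sum_(s : simplex K p.+1)
    c s *: \sum_(v in val s)
             (-1) ^+ vert_pos (val s) v *: simp_basis K p (val s :\ v).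

Fact simp_bd_linear K p : linear (@simp_bd_fun K p).
Proof.
move=> a c c'; rewrite /simp_bd_fun scaler_sumr -big_split /=.
by apply: eq_bigr => s _; rewrite !ffunE scalerDl scalerA.
Qed.

HB.instance Definition _ K p :=
  GRing.isLinear.Build k (simp_chain K p.+1) (simp_chain K p) _
    (@simp_bd_fun K p) (@simp_bd_linear K p).

Definition simp_bd K p : 'Hom(simp_chain K p.+1, simp_chain K p) :=
  linfun (@simp_bd_fun K p).


Lemma simp_bd_basis K p s : s \in K -> #|s| = p.+2 ->
  simp_bd K p (simp_basis K p.+1 s) =
  \sum_(v in s) (-1) ^+ vert_pos s v *: simp_basis K p (s :\ v).
Proof.
move=> sK sp; have sP : (s \in K) && (#|s| == p.+2) by rewrite sK sp eqxx.
rewrite lfunE /= /simp_bd_fun (bigD1 (exist _ s sP : simplex K p.+1)) //=.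
rewrite ffunE /= eqxx scale1r [X in _ + X]big1 ?addr0 // => t ts.
have -> : simp_basis K p.+1 s t = 0.
  by rewrite ffunE -[s]/(val (exist _ s sP : simplex K p.+1)) val_eqE (negbTE ts).
by rewrite scale0r.
Qed.

Lemma vert_posD1 (s : {set V}) v w : v \in s ->
  vert_pos s w = ((enum_rank v < enum_rank w)%N + vert_pos (s :\ v) w)%N.
Proof.
move=> vs; rewrite /vert_pos (cardsD1 v) !inE vs /=; congr (_ + _)%N.
by apply: eq_card => u; rewrite !inE andbA.
Qed.

Definition down_closed K : Prop :=
  forall s t : {set V}, s \in K -> t \subset s -> t != finset.set0 -> t \in K.

Lemma assoc_complex_closed H : down_closed (assoc_complex H).
Proof.
move=> s t; rewrite !inE => /andP[_ /exists_inP[u uH su]] ts -> /=.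
by apply/exists_inP; exists u => //; exact: fintype.subset_trans su.
Qed.

Lemma simp_bd_bd K p (c : simp_chain K p.+2) : down_closed K ->
  simp_bd K p (simp_bd K p.+1 c) = 0.
Proof.
move=> Kc; rewrite [X in simp_bd K p X]lfunE /= /simp_bd_fun linear_sum big1 //=.
move=> x _; rewrite linearZ /= linear_sum /=.
have : (sval x \in K) && (#|sval x| == p.+3) := valP x.
move: (c x) (sval x) => a s /andP[sK /eqP sp].
pose F v w := (-1) ^+ (vert_pos s v + vert_pos (s :\ v) w) *:
  simp_basis K p (s :\ v :\ w).
rewrite (eq_bigr (fun v => \sum_(w in s :\ v) F v w)); last first.
  move=> v vs; rewrite linearZ /= simp_bd_basis; first 1 last.
  - have cv : #|s :\ v| = p.+2 by move: (cardsD1 v s); rewrite vs sp => -[].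
    by apply: Kc sK _ _; rewrite ?subsetDl // -card_gt0 cv.
  - by move: (cardsD1 v s); rewrite vs sp => -[].
  by rewrite scaler_sumr; apply: eq_bigr => w _; rewrite scalerA -exprD.
pose r := fun v w : V => (enum_rank v < enum_rank w)%N.
have -> : \sum_(v in s) \sum_(w in s :\ v) F v w =
    \sum_(v in s) \sum_(w in s | r v w) F v w +
    \sum_(v in s) \sum_(w in s | r w v) F v w.
  rewrite -big_split; apply: eq_bigr => v vs /=.
  rewrite (bigID (r v)) /=; congr (_ + _); apply: eq_bigl => w.
    by rewrite !inE; case: (eqVneq w v) => [->|_] //=; rewrite /r ltnn andbF.
  rewrite !inE /r; case: (eqVneq w v) => [->|wv] /=; first by rewrite ltnn andbF.
  by rewrite -leqNgt leq_eqVlt val_eqE (inj_eq enum_rank_inj) (negbTE wv).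
rewrite [X in _ + X](exchange_big_dep (mem s)) /=; last by move=> v w _ /andP[].
rewrite -big_split big1 ?scaler0 // => v vs /=.
rewrite [X in _ + X](eq_bigl (fun w => (w \in s) && r v w)); last first.
  by move=> w; rewrite vs.
rewrite -big_split big1 //= => w /andP[ws vw]; rewrite /F.
have -> : s :\ w :\ v = s :\ v :\ w by apply/finset.setP=> u; rewrite !inE andbCA.
have nvw : (enum_rank w < enum_rank v)%N = false by apply/negbTE; rewrite -leqNgt ltnW.
rewrite [vert_pos s w](vert_posD1 w vs) [vert_pos s v](vert_posD1 v ws) nvw.
rewrite /r in vw; rewrite vw add0n add1n addSn exprS mulN1r scaleNr.
by rewrite [X in - (_ ^+ X *: _)]addnC subrr.
Qed.

Definition simp_complex H : complex k :=
  {| ch := simp_chain (assoc_complex H);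
     bd := simp_bd (assoc_complex H);
     bd_bd := fun p c => simp_bd_bd c (@assoc_complex_closed H) |}.

Definition hyper_chains H (H' : {set {set V}}) p : {vspace simp_complex H p} :=
  <<[seq simp_basis (assoc_complex H) p s
      | s <- enum [set s in H' | #|s| == p.+1]%SET]>>%VS.

Lemma hyper_chainsS H (H1 H2 : {set {set V}}) p :
  H1 \subset H2 -> (hyper_chains H H1 p <= hyper_chains H H2 p)%VS.
Proof.
move=> s12; apply: sub_span => _ /mapP[s sH ->]; apply: map_f.
by move: sH; rewrite !mem_enum !inE => /andP[/(fintype.subsetP s12)-> ->].
Qed.

End Hypergraph.

Section ExtendedReals.
Variable R : realType.

(* R, then infinity, then R with reversed order *)
Inductive ext : Type := Fin of R | Infty | Opp of R.

Definition ext_code (x : ext) : R + option R :=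
  match x with Fin a => inl a | Infty => inr None | Opp b => inr (Some b) end.
Definition ext_decode (x : R + option R) : ext :=
  match x with inl a => Fin a | inr None => Infty | inr (Some b) => Opp b end.
Lemma ext_codeK : cancel ext_code ext_decode. Proof. by case. Qed.

HB.instance Definition _ := Choice.copy ext (can_type ext_codeK).

Definition ext_le (x y : ext) : bool :=
  match x, y with
  | Fin a, Fin b => a <= b
  | Fin _, _ => true
  | Infty, Fin _ => false
  | Infty, _ => true
  | Opp a, Opp b => b <= a
  | Opp _, _ => false
  end.

Fact ext_le_refl : reflexive ext_le.
Proof. by case=> //= a; rewrite lexx. Qed.

Fact ext_le_anti : antisymmetric ext_le.
Proof. by case=> [a||a] [b||b] //= /le_anti ->. Qed.

Fact ext_le_trans : transitive ext_le.
Proof.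
case=> [a||a] [b||b] [c||c] //=; first exact: le_trans.
by move=> h1 h2; exact: le_trans h2 h1.
Qed.

Fact ext_le_total : total ext_le.
Proof. by case=> [a||a] [b||b] //=; exact: le_total. Qed.

Fact ext_display : Order.disp_t. Proof. exact: (Order.Disp tt tt). Qed.

HB.instance Definition _ := Order.Le_isPOrder.Build ext_display ext
  ext_le_refl ext_le_anti ext_le_trans.
HB.instance Definition _ :=
  Order.POrder_isTotal.Build ext_display ext ext_le_total.

End ExtendedReals.

Arguments Infty {R}.

Section PersistenceModule.
Variables (k : fieldType) (R : realType).

Record epmodule := EPModule {
  pobj :> ext R -> vectType k;
  pmap : forall x y : ext R, (x <= y)%O -> 'Hom(pobj x, pobj y);
  pmap_id : forall x (xx : (x <= x)%O), pmap xx = \1%VF;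
  pmap_comp : forall x y z (xy : (x <= y)%O) (yz : (y <= z)%O) (xz : (x <= z)%O),
    pmap xz = (pmap yz \o pmap xy)%VF }.

Definition epm_iso (M N : epmodule) : Prop :=
  exists phi : forall x, 'Hom(M x, N x),
    (forall x, bijective (phi x)) /\
    (forall x y (xy : (x <= y)%O) v, phi y (pmap M xy v) = pmap N xy (phi x v)).

Section IntervalModule.
Variable I : interval (ext R).

(* the dimension is the boolean (x \in I), read as 0 or 1, and the 1 x 1 matrix
   [const_mx 1] is the identity *)
Definition itv_obj (x : ext R) : vectType k := 'rV[k]_(x \in I).
Definition itv_map (x y : ext R) (xy : (x <= y)%O) :
    'Hom(itv_obj x, itv_obj y) :=
  linfun (mulmxr (const_mx 1 : 'M[k]_((x \in I), (y \in I)))).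

Fact itv_map_id x (xx : (x <= x)%O) : itv_map xx = \1%VF.
Proof.
apply/lfunP=> v; rewrite lfunE /= id_lfunE; move: v; rewrite /itv_obj.
case: (x \in I) => v; last by rewrite !thinmx0.
by apply/rowP=> i; rewrite !mxE big_ord1 mxE mulr1 !ord1.
Qed.

Fact itv_map_comp x y z (xy : (x <= y)%O) (yz : (y <= z)%O) (xz : (x <= z)%O) :
  itv_map xz = (itv_map yz \o itv_map xy)%VF.
Proof.
apply/lfunP=> v; rewrite comp_lfunE !lfunE /= -mulmxA; congr (_ *m _).
have : x \in I -> z \in I -> y \in I.
  case: I => a b; rewrite !itv_boundlr => /andP[ax _] /andP[_ zb].
  rewrite (le_trans ax) ?bnd_simp // (le_trans _ zb) // bnd_simp //.
case: (x \in I) (y \in I) (z \in I) => [] [] [] H; apply/matrixP=> -[i i0] [j j0] //.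
  by rewrite !mxE big_ord1 !mxE mulr1.
by have := H isT isT.
Qed.

Definition itv_module : epmodule :=
  {| pmap_id := itv_map_id; pmap_comp := itv_map_comp |}.

End IntervalModule.

Definition zero_obj (x : ext R) : vectType k := 'rV[k]_0.
Definition zero_map (x y : ext R) (xy : (x <= y)%O) :
  'Hom(zero_obj x, zero_obj y) := 0.

Fact zero_map_id x (xx : (x <= x)%O) : zero_map xx = \1%VF.
Proof. by apply/lfunP=> v; rewrite zero_lfunE id_lfunE [RHS]thinmx0. Qed.

Fact zero_map_comp x y z (xy : (x <= y)%O) (yz : (y <= z)%O) (xz : (x <= z)%O) :
  zero_map xz = (zero_map yz \o zero_map xy)%VF.
Proof. by apply/lfunP=> v; rewrite comp_lfunE !zero_lfunE. Qed.

Definition zero_module : epmodule :=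
  {| pmap_id := zero_map_id; pmap_comp := zero_map_comp |}.

Section DirectSum.
Variables M N : epmodule.

Definition dsum_obj (x : ext R) : vectType k := (M x * N x)%type.

Definition dsum_fun (x y : ext R) (xy : (x <= y)%O) (u : dsum_obj x) :
  dsum_obj y := (pmap M xy u.1, pmap N xy u.2).

Fact dsum_fun_linear x y (xy : (x <= y)%O) : linear (dsum_fun xy).
Proof. by move=> a u v; rewrite /dsum_fun !linearP. Qed.

HB.instance Definition _ x y (xy : (x <= y)%O) :=
  GRing.isLinear.Build k (dsum_obj x) (dsum_obj y) _
    (dsum_fun xy) (dsum_fun_linear xy).

Definition dsum_map (x y : ext R) (xy : (x <= y)%O) :
  'Hom(dsum_obj x, dsum_obj y) := linfun (dsum_fun xy).

Fact dsum_map_id x (xx : (x <= x)%O) : dsum_map xx = \1%VF.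
Proof.
apply/lfunP=> -[u v].
by rewrite lfunE id_lfunE /= /dsum_fun !pmap_id !id_lfunE.
Qed.

Fact dsum_map_comp x y z (xy : (x <= y)%O) (yz : (y <= z)%O) (xz : (x <= z)%O) :
  dsum_map xz = (dsum_map yz \o dsum_map xy)%VF.
Proof.
apply/lfunP=> u; rewrite comp_lfunE !lfunE /= /dsum_fun /=.
by rewrite (pmap_comp _ xy yz) (pmap_comp _ xy yz) !comp_lfunE.
Qed.

Definition dsum_module : epmodule :=
  {| pmap_id := dsum_map_id; pmap_comp := dsum_map_comp |}.

End DirectSum.

Definition itv_sum (B : seq (interval (ext R))) : epmodule :=
  foldr (fun I M => dsum_module (itv_module I) M) zero_module B.

Definition endpoint (I : interval (ext R)) (x : ext R) : Prop :=
  let: Interval l r := I in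
  (exists b, l = BSide b x) \/ (exists b, r = BSide b x).

Definition admissible (I : interval (ext R)) : Prop :=
  (exists x, x \in I) /\ ~ endpoint I Infty.

Definition decomposes (M : epmodule) (B : seq (interval (ext R))) : Prop :=
  (forall I, I \in B -> admissible I) /\ epm_iso M (itv_sum B).

Definition decomposable (M : epmodule) : Prop := exists B, decomposes M B.

Definition barcode (M : epmodule) : seq (interval (ext R)) :=
  xget [::] [set B | decomposes M B]%classic.

(* Multisets are represented by sequences up to permutation, and points of
   R^o by the corresponding real numbers. *)
Definition ord_point (I : interval (ext R)) : option (R * R) :=
  if I is Interval (BSide _ (Fin a)) (BSide _ (Fin b)) then Some (a, b)
  else None.
Definition rel_point (I : interval (ext R)) : option (R * R) :=
  if I is Interval (BSide _ (Opp a)) (BSide _ (Opp b)) then Some (a, b)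
  else None.
Definition ext_point (I : interval (ext R)) : option (R * R) :=
  if I is Interval (BSide _ (Fin a)) (BSide _ (Opp b)) then Some (a, b)
  else None.

Definition Ord (M : epmodule) : seq (R * R) := seq.pmap ord_point (barcode M).
Definition Rel (M : epmodule) : seq (R * R) := seq.pmap rel_point (barcode M).
Definition Ext (M : epmodule) : seq (R * R) := seq.pmap ext_point (barcode M).

Definition dist (u v : R * R) : R := Num.max `|u.1 - v.1| `|u.2 - v.2|.

Definition dist_diag (u : R * R) : R := inf (range (fun z : R => dist u (z, z))).

(* m lists the matched pairs; A0 and B0 list the unmatched points *)
Definition partial_matching (A B : seq (R * R)) (m : seq ((R * R) * (R * R)))
    (A0 B0 : seq (R * R)) : Prop :=
  perm_eq A (unzip1 m ++ A0) /\ perm_eq B (unzip2 m ++ B0).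

Definition partial_matched (delta : R) (A B : seq (R * R)) : Prop :=
  exists m A0 B0,
    [/\ partial_matching A B m A0 B0,
        (forall u, u \in m -> dist u.1 u.2 <= delta),
        (forall u, u \in A0 -> dist_diag u <= delta) &
        (forall u, u \in B0 -> dist_diag u <= delta)].

Definition perfect_matched (delta : R) (A B : seq (R * R)) : Prop :=
  exists m, partial_matching A B m [::] [::] /\
    (forall u, u \in m -> dist u.1 u.2 <= delta).

(* the diagrams are only meaningful for decomposable modules *)
Definition matched (delta : R) (M N : epmodule) : Prop :=
  [/\ decomposable M /\ decomposable N,
      partial_matched delta (Ord M) (Ord N),
      partial_matched delta (Rel M) (Rel N) &
      perfect_matched delta (Ext M) (Ext N)].

Definition bottleneck (M N : epmodule) : \bar R :=
  ereal_inf [set delta%:E | delta in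
              [set delta : R | 0 < delta /\ matched delta M N]]%classic.

End PersistenceModule.

Section HypergraphPersistence.
Variables (k : fieldType) (R : realType) (V : finType).

Definition hyperedge (H : {set {set V}}) := {s : {set V} | s \in H}.

Definition sup_dist (H : {set {set V}}) (f g : hyperedge H -> R) : R :=
  sup (range (fun s => `|f s - g s|)).

Variables (H : {set {set V}}) (f : hyperedge H -> R).

Definition sublevel (a : R) : {set {set V}} :=
  [set val s | s : hyperedge H & f s <= a]%SET.

Definition superlevel (a : R) : {set {set V}} :=
  [set val s | s : hyperedge H & a <= f s]%SET.

Local Notation chains H' := (hyper_chains k H H').

Definition level_complex (x : ext R) : complex k :=
  match x with
  | Fin a => supcomplex (chains (sublevel a))
  | Infty => supcomplex (chains H)
  | Opp a => supcomplex_rel (chains H) (chains (superlevel a))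
  end.

(* The remaining cases of x and y, which cannot satisfy x <= y, get 0. *)
Definition level_map (x y : ext R) p :
    'Hom(level_complex x p, level_complex y p) :=
  match x, y return 'Hom(level_complex x p, level_complex y p) with
  | Fin a, Fin b =>
      supcomplex_incl (chains (sublevel a)) (chains (sublevel b)) p
  | Fin a, Infty => supcomplex_incl (chains (sublevel a)) (chains H) p
  | Fin a, Opp b =>
      (supcomplex_proj (chains H) (chains (superlevel b)) p \o
       supcomplex_incl (chains (sublevel a)) (chains H) p)%VF
  | Infty, Infty => supcomplex_incl (chains H) (chains H) p
  | Infty, Opp b => supcomplex_proj (chains H) (chains (superlevel b)) p
  | Opp a, Opp b =>
      supcomplex_rel_map (chains H) (chains (superlevel a))
                         (chains H) (chains (superlevel b)) p
  | _, _ => 0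
  end.

Lemma sublevel_sub a : sublevel a \subset H.
Proof. by apply/fintype.subsetP=> _ /imsetP[s _ ->]; exact: valP. Qed.

Lemma sublevelS a b : a <= b -> sublevel a \subset sublevel b.
Proof.
move=> ab; apply/fintype.subsetP=> _ /imsetP[s + ->]; rewrite inE => fs.
by apply: imset_f; rewrite inE (le_trans fs).
Qed.

Lemma superlevelS a b : a <= b -> superlevel b \subset superlevel a.
Proof.
move=> ab; apply/fintype.subsetP=> _ /imsetP[s + ->]; rewrite inE => fs.
by apply: imset_f; rewrite inE (le_trans ab).
Qed.

Lemma level_map_chain x y : (x <= y)%O -> chain_map (level_map x y).
Proof.
case: x y => [a||a] [b||b] //= xy.
- by apply: supcomplex_incl_chain => q; rewrite hyper_chainsS ?sublevelS.
- by apply: supcomplex_incl_chain => q; rewrite hyper_chainsS ?sublevel_sub.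
- have sub q : (chains (sublevel a) q <= chains H q)%VS.
    by rewrite hyper_chainsS ?sublevel_sub.
  exact: chain_map_comp (supcomplex_incl_chain sub) (supcomplex_proj_chain _).
- exact: supcomplex_incl_chain.
- exact: supcomplex_proj_chain.
- apply: supcomplex_rel_map_chain => // q.
  by rewrite hyper_chainsS ?superlevelS.
Qed.

Lemma level_map_id x p v : level_map x x p v = v.
Proof.
case: x v => [a||a] v.
- exact: (supcomplex_incl_id (D := chains (sublevel a))).
- exact: (supcomplex_incl_id (D := chains H)).
- elim/quot_ind: v => v.
  rewrite [LHS](supcomplex_rel_mapE (E := chains (superlevel a))) //.
  by rewrite supcomplex_incl_id.
Qed.

Lemma level_map_comp x y z p v : (x <= y)%O -> (y <= z)%O ->
  level_map x z p v = level_map y z p (level_map x y p v).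
Proof.
have sub a q : (chains (sublevel a) q <= chains H q)%VS.
  by rewrite hyper_chainsS ?sublevel_sub.
have sub2 a b (ab : a <= b) q :
    (chains (sublevel a) q <= chains (sublevel b) q)%VS.
  by rewrite hyper_chainsS ?sublevelS.
have sup2 a b (ab : b <= a) q :
    (chains (superlevel a) q <= chains (superlevel b) q)%VS.
  by rewrite hyper_chainsS ?superlevelS.
have relE a b (w : supcomplex (chains H) p) (ab : b <= a) :
    supcomplex_rel_map (chains H) (chains (superlevel a)) (chains H)
      (chains (superlevel b)) p (supcomplex_proj (chains H) _ p w) =
    supcomplex_proj (chains H) (chains (superlevel b)) p
      (supcomplex_incl (chains H) (chains H) p w).
  by apply: supcomplex_rel_mapE => //; exact: sup2.
case: x v => [a||a] v; case: y => [b||b]; case: z => [c||c] //= xy yz.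
- exact: (supcomplex_incl_comp (D := chains (sublevel a)) _ (sub2 _ _ xy) (sub2 _ _ yz)).
- exact: (supcomplex_incl_comp (D := chains (sublevel a)) _ (sub2 _ _ xy) (sub _)).
- rewrite [LHS]comp_lfunE [RHS]comp_lfunE; apply: congr1.
  exact: (supcomplex_incl_comp (D := chains (sublevel a)) _ (sub2 _ _ xy) (sub _)).
- exact: (supcomplex_incl_comp (D := chains (sublevel a)) _ (sub _) (fun=> subvv _)).
- exact: comp_lfunE.
- rewrite [LHS]comp_lfunE [X in _ = _ X]comp_lfunE.
  by rewrite [RHS](relE _ _ _ yz) [X in _ = _ X]supcomplex_incl_id.
- by rewrite [X in _ = _ X](supcomplex_incl_id (D := chains H)).
- by rewrite [X in _ = _ X](supcomplex_incl_id (D := chains H)).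
- by rewrite [RHS](relE _ _ _ yz) [X in _ = _ X](supcomplex_incl_id (D := chains H)).
- elim/quot_ind: v => v.
  have ca : c <= a := le_trans (yz : c <= b) (xy : b <= a).
  rewrite [LHS](relE _ _ _ ca) [X in _ = _ X](relE _ _ _ xy).
  by rewrite [RHS](relE _ _ _ yz) !(supcomplex_incl_id (D := chains H)).
Qed.

Variable p : nat.

Fact level_hmap_id x (xx : (x <= x)%O) :
  homology_map (level_map x x) p = \1%VF.
Proof. exact/homology_map_id/level_map_id. Qed.

Fact level_hmap_comp x y z (xy : (x <= y)%O) (yz : (y <= z)%O)
    (xz : (x <= z)%O) :
  homology_map (level_map x z) p =
  (homology_map (level_map y z) p \o homology_map (level_map x y) p)%VF.
Proof.
apply: homology_map_comp; try exact: level_map_chain.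
by move=> q v; exact: level_map_comp.
Qed.

Definition hyper_module : epmodule k R :=
  {| pobj := fun x => homology (level_complex x) p;
     pmap := fun x y _ => homology_map (level_map x y) p;
     pmap_id := level_hmap_id;
     pmap_comp := level_hmap_comp |}.

End HypergraphPersistence.

(* Main.v *)
Require Import Defs.
From HB Require Import structures.
From mathcomp Require Import all_boot all_order all_algebra.
From mathcomp Require Import boolp classical_sets reals constructive_ereal ereal.
From mathcomp Require Import ring.

Set Implicit Arguments.
Unset Strict Implicit.
Unset Printing Implicit Defensive.

Import Order.TTheory GRing.Theory Num.Theory.
Local Open Scope ring_scope.

(** Everything happens along a finite chain of pairs.  List all hyperedges as
    l = (s_1, ..., s_n) and consider the pairs of hyperedge sets

      (first m entries, empty), for m <= n, then
      (all, last m - n entries), for n <= m <= 2n.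

    Relative homology of these pairs is a functor on 0, ..., 2n.  If f is
    nondecreasing along l, then every level of the extended filtration of f is
    one of these pairs, so the persistence module of f is the pullback of that
    functor along a monotone map from the extended line to 0, ..., 2n
    ([level_pair_edge_chain], [hyper_module_pullback]).  The functor splits into
    interval functors ([chain_decomposition]), and the preimage of an interval
    with ends i < j is the half-open interval between the i-th and the j-th
    event of f, where the events are the values of f in increasing order and
    then, reversed, the same values on the opposite line ([common_bars]).  The
    pairs do not mention f: two functions nondecreasing along the same list
    have the same bars, with ends f(s) and g(s) for the same hyperedges s.
    Hence these ends differ by at most the sup distance, on the same half of
    the line.  A bar within one half of the line is empty only if its two end
    values agree, so that it lies on the diagonal, and a bar across infinity
    is never empty ([bars_close]).

    Two functions have a common such list, namely any list sorted by f + g,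
    exactly when they never order two hyperedges in strictly opposite ways.
    In general, move from f to g along the segment (1 - x) f + x g, and stop
    at the first time two hyperedges in strictly opposite order meet.  The
    first part is compatible, the second part has fewer opposite pairs, and
    the sup distances of the two parts add up to that of f and g.  Induction
    and the triangle inequality for matchings ([padded_matched_trans])
    conclude ([close_of_sup_le]).

    The diagrams are read off an arbitrarily chosen decomposition, so the
    argument also needs that a decomposition is unique ([barcode_unique]).
    The ranks of the structure maps count the intervals that contain two given
    points, and these counts determine the intervals by peeling off an
    inclusion-maximal one. *)

(** * Splitting a chain of vector spaces into bars *)

Section ChainDecomposition.
Variables (k : fieldType) (X : nat -> vectType k).
Variable F : forall m n, 'Hom(X m, X n).
Hypothesis F_id : forall m x, F m m x = x.
Hypothesis F_comp : forall l m n x,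
  (l <= m)%N -> (m <= n)%N -> F m n (F l m x) = F l n x.

(** A bar records its birth, the vector born there, and its death.  The whole
    family of images is recovered by [bar_elt]; storing only the first vector
    keeps bars in a type with decidable equality. *)
Definition bar := ({i : nat & X i} * nat)%type.
Definition birth (b : bar) : nat := tag b.1.
Definition death (b : bar) : nat := b.2.
Definition alive (b : bar) (m : nat) := (birth b <= m < death b)%N.
Definition bar_elt (b : bar) (m : nat) : X m := F (birth b) m (tagged b.1).

Definition bar_basis (W : forall m, {vspace X m}) (s : seq bar) :=
  forall m, basis_of (W m) [seq bar_elt b m | b <- s & alive b m].

Lemma bar_elt_transport b m n : bar_elt b (death b) = 0 ->
  (birth b <= m < death b)%N -> (m <= n)%N ->
  F m n (bar_elt b m) = if (birth b <= n < death b)%N then bar_elt b n else 0.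
Proof.
move=> bd /andP[bm md] mn; rewrite /bar_elt F_comp //.
case: ifP => // /negbT; rewrite (leq_trans bm mn) /= -leqNgt => dn.
rewrite -(F_comp _ _ dn) ?(ltnW (leq_ltn_trans bm md)) //.
by rewrite -/(bar_elt b _) bd linear0.
Qed.

(** The images of v up to its death span a direct summand.  Choose a complement
    of the line through the last nonzero image of v and pull it back to the
    earlier spaces.  The result is stable because W vanishes before the birth
    of v, and because nothing is imposed from its death on. *)
Lemma split_bar (W : forall m, {vspace X m}) (i j : nat) (v : X i) :
  (forall m n, (m <= n)%N -> (F m n @: W m <= W n)%VS) ->
  (forall m, (m < i)%N -> W m = 0%VS) -> (i < j)%N -> v \in W i ->
  (forall m, (i <= m < j)%N -> F i m v != 0) ->
  exists W' : forall m, {vspace X m},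
    [/\ forall m n, (m <= n)%N -> (F m n @: W' m <= W' n)%VS,
        forall m, (W' m <= W m)%VS, v \notin W' i &
        forall m, if (i <= m < j)%N
          then F i m v \notin W' m /\ (W m = <[F i m v]> + W' m)%VS
          else W' m = W m].
Proof.
move=> WF W0 ij vW vm0.
have j1E : j.-1.+1 = j := ltn_predK ij.
have ij1 : (i <= j.-1)%N by rewrite -ltnS j1E.
have j1j : (j.-1 < j)%N by rewrite j1E.
set w := F i j.-1 v; have w0 : w != 0 by rewrite vm0 // ij1.
have wU : w \notin (<[w]>^C)%VS.
  apply: contra w0 => wC; rewrite -memv0 -(capv_compl <[w]>%VS) memv_cap wC.
  by rewrite memv_line.
pose K m := (W m :&: (F m j.-1 @^-1: <[w]>^C))%VS.
pose W' m := if (i <= m < j)%N then K m else W m.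
have W'W m : (W' m <= W m)%VS by rewrite /W'; case: ifP => // _; rewrite capvSl.
have vmW' m : (i <= m < j)%N -> F i m v \notin W' m.
  move=> mP; rewrite /W' mP memv_cap -memv_preim negb_and; apply/orP; right.
  by case/andP: mP => im mj; rewrite F_comp // -ltnS j1E.
exists W'; split => //.
- move=> m n mn; apply/subvP=> _ /memv_imgP[x xW' ->].
  have xW := subvP (W'W m) _ xW'.
  have FxW : F m n x \in W n by apply: (subvP (WF _ _ mn)); rewrite memv_img.
  rewrite /W'; case: ifP => // /andP[_ nj].
  case: (leqP i m) => [im|mi]; last first.
    by move: xW; rewrite W0 // memv0 => /eqP->; rewrite linear0 mem0v.
  rewrite /K memv_cap FxW -memv_preim F_comp //; last by rewrite -ltnS j1E.
  move: xW'; rewrite /W' im (leq_ltn_trans mn nj).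
  by rewrite memv_cap -memv_preim => /andP[].
- by rewrite -[v]F_id vmW' // leqnn.
- move=> m; case: ifP => mP; last by rewrite /W' mP.
  split; first exact: vmW'.
  have /andP[im mj] := mP.
  have vmW : F i m v \in W m by apply: (subvP (WF _ _ im)); rewrite memv_img.
  apply/eqP; rewrite eqEsubv subv_add W'W -memvE vmW !andbT.
  apply/subvP=> x xW.
  have : F m j.-1 x \in (<[w]> + <[w]>^C)%VS by rewrite addv_complf memvf.
  case/memv_addP=> _ /vlineP[a ->] [u uU xE].
  rewrite -[x](subrK (a *: F i m v)) addrC memv_add ?memvZ ?memv_line //.
  rewrite /W' mP memv_cap -memv_preim rpredB ?memvZ //= linearB linearZ /=.
  rewrite F_comp //; last by rewrite -ltnS j1E.
  by rewrite xE addrC addKr.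
Qed.

(** Split off the bar of any nonzero vector born as early as possible, so that
    W vanishes before its birth.  The total dimension decreases.  The statement is about
    stable families of subspaces rather than about functors, because the
    complement that remains is such a family. *)
Theorem chain_decomposition N (W : forall m, {vspace X m}) :
  (forall m n, (m <= n)%N -> (F m n @: W m <= W n)%VS) ->
  W 0%N = 0%VS -> (forall m, (N <= m)%N -> W m = 0%VS) ->
  exists s : seq bar, bar_basis W s /\
    forall b, b \in s -> (0 < birth b < death b)%N && (death b <= N)%N /\
      bar_elt b (death b) = 0.
Proof.
have [d] := ubnP (\sum_(m < N) \dim (W m)); elim: d W => // d IH W Wd WF W00 WN.
case: (pselect (exists i, W i != 0%VS)) => [iP|all0]; last first.
  exists [::]; split=> // m /=; have -> : W m = 0%VS.
    by apply/eqP; apply: contra_notT all0; exists m.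
  by rewrite /basis_of span_nil nil_free eqxx.
case: (ex_minnP iP) => i Wi0 imin.
have iN : (i < N)%N by rewrite ltnNge; apply: contra Wi0 => /WN ->.
have Wlt m : (m < i)%N -> W m = 0%VS.
  by move=> mi; apply/eqP; apply: contraTT mi => /imin; rewrite -leqNgt.
have i0 : (0 < i)%N by rewrite lt0n; apply: contra Wi0 => /eqP ->; rewrite W00.
pose v := vpick (W i); have vW : v \in W i := memv_pick _.
have v0 : v != 0 by rewrite vpick0.
have jP : exists j, (i < j)%N && (F i j v == 0).
  exists N; rewrite iN -memv0 -(WN N) //.
  by apply: (subvP (WF _ _ (ltnW iN))); rewrite memv_img.
case: (ex_minnP jP) => j /andP[ij /eqP Fj0] jmin.
have jN : (j <= N)%N.
  apply: jmin; rewrite iN -memv0 -(WN N) //.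
  by apply: (subvP (WF _ _ (ltnW iN))); rewrite memv_img.
have vm m : (i <= m < j)%N -> F i m v != 0.
  case/andP; rewrite leq_eqVlt => /orP[/eqP<- _|im mj]; first by rewrite F_id.
  by apply: contraTN mj => Fm; rewrite -leqNgt jmin // im.
have [W' [WF' W'W vW' W'E]] := split_bar WF Wlt ij vW vm.
have [||m Nm|s [sB sP]] := IH W' _ WF'.
- apply: leq_trans _ (Wd : (_ <= d)%N); rewrite (bigD1 (Ordinal iN)) //=.
  rewrite [X in (_ < X)%N](bigD1 (Ordinal iN)) //= -addSn leq_add //.
    rewrite ltn_neqAle dimvS // andbT; apply: contra vW' => /eqP dE.
    by have /eqP -> : W' i == W i by rewrite eqEdim W'W dE /=.
  by apply: leq_sum => m _; rewrite dimvS.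
- by apply/eqP; rewrite -subv0 -W00.
- by apply/eqP; rewrite -subv0 -(WN m).
exists ((Tagged X v, j) :: s); split; last first.
  move=> b; rewrite inE => /orP[/eqP->|/sP //].
  by rewrite /bar_elt /birth /death /= i0 ij jN.
move=> m /=; rewrite {1}/alive /birth /death /=.
move: (W'E m) (sB m); case: ifP => mP; last by move=> ->.
case=> nin -> /andP[/eqP sp fr]; rewrite /= /basis_of span_cons free_cons sp fr.
by rewrite /bar_elt /birth /= nin eqxx.
Qed.

End ChainDecomposition.

(** * Interval decompositions from compatible bases *)

Section Isomorphism.
Variables (k : fieldType) (R : realType).
Implicit Types M N : epmodule k R.

Lemma natural_inverse_iso M N (psi : forall x, 'Hom(N x, M x)) :
  (forall x, lker (psi x) == 0%VS) -> (forall x, limg (psi x) = fullv) ->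
  (forall x y (xy : (x <= y)%O) u,
    psi y (Defs.pmap N xy u) = Defs.pmap M xy (psi x u)) -> epm_iso M N.
Proof.
move=> k0 im nat; exists (fun x => (psi x)^-1%VF).
have psiK x : cancel (psi x) (psi x)^-1%VF := lker0_lfunK (k0 x).
have psiVK x : cancel (psi x)^-1%VF (psi x).
  by move=> v; rewrite limg_lfunVK // im memvf.
split=> [x|x y xy v]; first by exists (psi x).
by rewrite -[RHS](psiK y) nat psiVK.
Qed.

Lemma epm_iso_trans N M P : epm_iso M N -> epm_iso N P -> epm_iso M P.
Proof.
case=> f [fb fn] [g [gb gn]]; exists (fun x => (g x \o f x)%VF); split.
  move=> x; apply: (eq_bij (bij_comp (gb x) (fb x))) => v.
  by rewrite comp_lfunE.
by move=> x y xy v; rewrite !comp_lfunE fn gn.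
Qed.

(** The only coordinate of a vector of an interval module where it is nonzero,
    and 0 elsewhere: a coordinate that needs no case distinction on the
    dimension. *)
Definition row_sum (n : nat) (v : 'rV[k]_n) : k := \sum_j v 0 j.

Lemma row_sumP n a (u v : 'rV[k]_n) :
  row_sum (a *: u + v) = a * row_sum u + row_sum v.
Proof.
rewrite /row_sum mulr_sumr -big_split /=.
by apply: eq_bigr => j _; rewrite !mxE.
Qed.

Lemma row_sum0 n : row_sum (0 : 'rV[k]_n) = 0.
Proof. by rewrite /row_sum big1 // => j _; rewrite mxE. Qed.

Lemma itv_module_out (I : interval (ext R)) x (v : itv_module k I x) :
  (x \in I) = false -> v = 0.
Proof.
move: v; rewrite /= /itv_obj => v xI; move: v.
by rewrite xI => v; apply/rowP=> -[].
Qed.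

Lemma row_sum_out (I : interval (ext R)) x (v : itv_module k I x) :
  (x \in I) = false -> row_sum v = 0.
Proof. by move=> xI; rewrite (itv_module_out v xI) row_sum0. Qed.

Lemma row_sum_itv_map (I : interval (ext R)) x y (xy : (x <= y)%O)
    (v : itv_module k I x) :
  row_sum (Defs.pmap (itv_module k I) xy v) = if y \in I then row_sum v else 0.
Proof.
rewrite /row_sum /= /itv_map lfunE /=; move: v; rewrite /= /itv_obj.
case: (x \in I) (y \in I) => [] [] v; rewrite ?big_ord0 //.
- by rewrite !big_ord1 !mxE big_ord1 mxE mulr1 ord1.
- by rewrite big_ord1 !mxE big_ord0.
Qed.

Variables (M : epmodule k R) (T : eqType) (I : T -> interval (ext R)).
Variable e : T -> forall x, M x.

(** The map from the sum of the intervals I b that sends the generator of the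
    b-th interval at x to e b x. *)
Fixpoint from_sum_fun (s : seq T) x : itv_sum k (map I s) x -> M x :=
  if s is b :: s' return itv_sum k (map I s) x -> M x
  then fun u => row_sum u.1 *: e b x + @from_sum_fun s' x u.2
  else fun=> 0.

Lemma from_sum_linear s x : linear (@from_sum_fun s x).
Proof.
elim: s => [|b s IH] a u v /=; first by rewrite scaler0 addr0.
by rewrite IH row_sumP scalerDl scalerDr scalerA addrACA.
Qed.

HB.instance Definition _ s x := GRing.isLinear.Build k _ _ _
  (@from_sum_fun s x) (@from_sum_linear s x).

Definition from_sum s x : 'Hom(itv_sum k (map I s) x, M x) :=
  linfun (@from_sum_fun s x).

Lemma from_sum_cons b s x (u : itv_sum k (map I (b :: s)) x) :
  from_sum (b :: s) x u = row_sum u.1 *: e b x + from_sum s x u.2.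
Proof. by rewrite /from_sum !lfunE. Qed.

Lemma from_sum_natural s x y (xy : (x <= y)%O) u :
  (forall b, b \in s -> x \in I b ->
     Defs.pmap M xy (e b x) = if y \in I b then e b y else 0) ->
  from_sum s y (Defs.pmap (itv_sum k (map I s)) xy u) =
  Defs.pmap M xy (from_sum s x u).
Proof.
elim: s u => [|b s IH] u nat; first by rewrite !lfunE /= linear0.
case: u => u1 u2.
rewrite [in RHS]from_sum_cons [in RHS]linearD [in RHS]linearZ /=.
rewrite from_sum_cons [X in row_sum X.1]lfunE [X in from_sum s y X.2]lfunE /=.
congr (_ + _); last first.
  by apply: IH => c cs; apply: nat; rewrite inE cs orbT.
rewrite [X in X *: _](row_sum_itv_map xy).
have /orP[xI|/negbTE xI] := orbN (x \in I b).
  by rewrite nat ?mem_head //; case: ifP => _; rewrite ?scale0r ?scaler0.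
by rewrite (row_sum_out u1 xI) if_same !scale0r.
Qed.

Lemma row_sum_bool_inj (c : bool) (v : 'rV[k]_c) : row_sum v = 0 -> v = 0.
Proof.
case: c v => v; last by move=> _; apply/rowP=> -[].
by rewrite /row_sum big_ord1 => v0; apply/rowP=> i; rewrite ord1 v0 mxE.
Qed.

Lemma from_sum_span s x u :
  from_sum s x u \in <<[seq e b x | b <- s & x \in I b]>>%VS.
Proof.
elim: s u => [|b s IH] u; first by rewrite lfunE mem0v.
rewrite from_sum_cons; move: (IH u.2) (row_sum u.1) (row_sum_out u.1).
move: (from_sum s x u.2) => v vs a a0 /=; case: ifP a0 => [_ _|_ ->] //.
  by rewrite span_cons memv_add ?memvZ ?memv_line.
by rewrite scale0r add0r.
Qed.

Lemma from_sum_inj s x : free [seq e b x | b <- s & x \in I b] ->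
  lker (from_sum s x) == 0%VS.
Proof.
move=> fr; apply/lker0P => u v uv; apply/eqP; rewrite -subr_eq0; apply/eqP.
have {uv} : from_sum s x (u - v) = 0 by rewrite linearB /= uv subrr.
elim: s {u v}(u - v) fr => [|b s IH] u fr; first by move=> _; apply/rowP=> -[].
rewrite from_sum_cons; case: u => u1 u2 /= u0.
suff u10 : row_sum u1 = 0.
  move: u0; rewrite u10 scale0r add0r => /IH ->; last first.
    by move: fr => /=; case: ifP => // _; rewrite free_cons => /andP[].
  by rewrite (row_sum_bool_inj u10).
move: (row_sum_out u1) u0 fr; move: (row_sum u1) => {u1} a a0 u0 /=.
case: ifP a0 => [_ _|_ ->] //.
rewrite free_cons => /andP[nin _]; apply: contraNeq nin => r0.
have -> : e b x = a^-1 *: - from_sum s x u2.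
  by apply: (scalerI r0); rewrite scalerA mulfV // scale1r; apply/eqP;
     rewrite -subr_eq0 opprK u0.
by rewrite memvZ // memvN from_sum_span.
Qed.

Lemma from_sum_surj s x :
  basis_of fullv [seq e b x | b <- s & x \in I b] ->
  limg (from_sum s x) = fullv.
Proof.
case/andP=> /eqP sp _; apply/eqP; rewrite eqEsubv subvf -sp.
elim: s {sp} => [|b s IH]; first by rewrite span_nil sub0v.
have sub : (limg (from_sum s x) <= limg (from_sum (b :: s) x))%VS.
  apply/subvP=> _ /memv_imgP[u _ ->].
  have -> : from_sum s x u =
      from_sum (b :: s) x ((0, u) : dsum_obj _ _ x).
    by rewrite from_sum_cons /= row_sum0 scale0r add0r.
  by rewrite memv_img ?memvf.
have {}IH := subv_trans IH sub.
move: IH sub => /=; case: ifP => // xI IH sub.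
rewrite span_cons subv_add IH andbT -memvE.
have [v v1] : exists v : itv_module k (I b) x, row_sum v = 1.
  rewrite /= /itv_obj xI; exists (const_mx 1).
  by rewrite /row_sum big_ord1 mxE.
have -> : e b x = from_sum (b :: s) x ((v, 0) : dsum_obj _ _ x).
  by rewrite from_sum_cons /= v1 scale1r linear0 addr0.
by rewrite memv_img ?memvf.
Qed.

(** The second hypothesis makes [from_sum] bijective at each point, the first
    one makes it natural. *)
Theorem interval_sum_of_bases (s : seq T) :
  (forall b x y (xy : (x <= y)%O), b \in s -> x \in I b ->
     Defs.pmap M xy (e b x) = if y \in I b then e b y else 0) ->
  (forall x, basis_of fullv [seq e b x | b <- s & x \in I b]) ->
  epm_iso M (itv_sum k (map I s)).
Proof.
move=> nat bas; apply: (natural_inverse_iso (psi := from_sum s)).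
- by move=> x; apply: from_sum_inj; have /andP[] := bas x.
- by move=> x; apply: from_sum_surj.
- by move=> x y xy u; apply: from_sum_natural => b; apply: nat.
Qed.

End Isomorphism.

(** * Uniqueness of the barcode *)

Section BarcodeUniqueness.
Variables (k : fieldType) (R : realType).

Section DirectSumRank.
Variables (M N : epmodule k R).

Definition inl_fun x (u : M x) : dsum_obj M N x := (u, 0).
Definition inr_fun x (v : N x) : dsum_obj M N x := (0, v).

Lemma inl_linear x : linear (@inl_fun x).
Proof.
by move=> a u v; apply: injective_projections => /=; rewrite ?scaler0 ?addr0.
Qed.

Lemma inr_linear x : linear (@inr_fun x).
Proof.
by move=> a u v; apply: injective_projections => /=; rewrite ?scaler0 ?addr0.
Qed.

HB.instance Definition _ x := GRing.isLinear.Build k (M x) (dsum_obj M N x) _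
  (@inl_fun x) (@inl_linear x).
HB.instance Definition _ x := GRing.isLinear.Build k (N x) (dsum_obj M N x) _
  (@inr_fun x) (@inr_linear x).

Lemma rank_dsum x y (xy : (x <= y)%O) :
  \dim (limg (Defs.pmap (dsum_module M N) xy)) =
  (\dim (limg (Defs.pmap M xy)) + \dim (limg (Defs.pmap N xy)))%N.
Proof.
set f := Defs.pmap M xy; set g := Defs.pmap N xy; rewrite /=.
have hE u : dsum_map M N xy u = (f u.1, g u.2) by rewrite lfunE.
pose il := linfun (@inl_fun y); pose ir := linfun (@inr_fun y).
have -> : (limg (dsum_map M N xy) = il @: limg f + ir @: limg g)%VS.
  apply/eqP; rewrite eqEsubv subv_add; apply/and3P; split.
  - apply/subvP=> _ /memv_imgP[u _ ->].
    have -> : dsum_map M N xy u = il (f u.1) + ir (g u.2).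
      rewrite hE !lfunE /= /inl_fun /inr_fun.
      by apply: injective_projections; rewrite /= ?addr0 ?add0r.
    by rewrite memv_add ?memv_img ?memvf.
  - apply/subvP=> _ /memv_imgP[_ /memv_imgP[u _ ->] ->].
    have -> : il (f u) = dsum_map M N xy (u, 0) by rewrite hE lfunE /= linear0.
    by rewrite memv_img ?memvf.
  - apply/subvP=> _ /memv_imgP[_ /memv_imgP[u _ ->] ->].
    have -> : ir (g u) = dsum_map M N xy (0, u) by rewrite hE lfunE /= linear0.
    by rewrite memv_img ?memvf.
have il0 : (limg f :&: lker il = 0)%VS.
  rewrite (_ : lker il = 0%VS) ?capv0 //; apply/eqP/lker0P => u v.
  by rewrite !lfunE => -[].
have ir0 : (limg g :&: lker ir = 0)%VS.
  rewrite (_ : lker ir = 0%VS) ?capv0 //; apply/eqP/lker0P => u v.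
  by rewrite !lfunE => -[].
rewrite dimv_disjoint_sum ?(limg_dim_eq il0) ?(limg_dim_eq ir0) //.
apply/eqP; rewrite -subv0; apply/subvP=> w.
rewrite memv_cap => /andP[/memv_imgP[u _ ->] /memv_imgP[v _]].
by rewrite !lfunE /= => -[-> _]; rewrite /inl_fun mem0v.
Qed.

End DirectSumRank.

Definition contains_both (x y : ext R) (I : interval (ext R)) :=
  (x \in I) && (y \in I).

Lemma rank_itv_sum (B : seq (interval (ext R))) x y (xy : (x <= y)%O) :
  \dim (limg (Defs.pmap (itv_sum k B) xy)) = count (contains_both x y) B.
Proof.
elim: B => [|I B IH] /=; first by rewrite lim0g dimv0.
rewrite rank_dsum IH; congr (_ + _)%N; rewrite /contains_both {IH} /=.
have dimI z : \dim {: itv_obj k I z} = (z \in I) by rewrite dimvf /dim /= mul1n.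
have le_y := dimvS (subvf (limg (itv_map k I xy))); rewrite dimI in le_y.
have ker_im := limg_ker_dim (itv_map k I xy) fullv; rewrite dimI in ker_im.
have [yI|/negbTE yI] := boolP (y \in I); last first.
  by move: le_y; rewrite yI leqn0 andbF => /eqP.
have [xI|/negbTE xI] := boolP (x \in I); last first.
  by move/eqP: ker_im; rewrite xI addn_eq0 => /andP[_ /eqP].
rewrite -[RHS]/(true : nat) -xI -ker_im.
suff -> : (fullv :&: lker (itv_map k I xy) = 0)%VS by rewrite dimv0.
apply/eqP; rewrite -subv0; apply/subvP=> v; rewrite memv_cap memv_ker.
case/andP=> _; rewrite lfunE /= memv0 => /eqP /rowP v0.
apply/eqP; move: v v0; rewrite /itv_obj xI yI => v /(_ 0).
by rewrite !mxE big_ord1 mxE mulr1 => v0; apply/rowP=> i; rewrite ord1 v0 mxE.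
Qed.

Lemma epm_iso_rank (M N : epmodule k R) x y (xy : (x <= y)%O) : epm_iso M N ->
  \dim (limg (Defs.pmap M xy)) = \dim (limg (Defs.pmap N xy)).
Proof.
case=> phi [bij nat].
have k0 z : lker (phi z) == 0%VS by apply/lker0P; exact: bij_inj.
rewrite -(limg_dim_eq (f := phi y)) ?(eqP (k0 y)) ?capv0 //.
congr (\dim _); apply/eqP; rewrite eqEsubv; apply/andP; split.
apply/subvP=> _ /memv_imgP[_ /memv_imgP[u _ ->] ->].
by rewrite nat memv_img ?memvf.
apply/subvP=> _ /memv_imgP[v _ ->].
have [g _ gK] := bij x; rewrite -(gK v) -nat.
by rewrite !memv_img ?memvf.
Qed.

Lemma ext_between (x y : ext R) : (x < y)%O -> exists z, (x < z < y)%O.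
Proof.
have lt1 (a : R) : a < a + 1 by rewrite ltrDl.
have le1 (a : R) : (a + 1 <= a) = false by apply/negbTE; rewrite -ltNge.
rewrite lt_leAnge => /andP[]; rewrite /Order.le /=.
case: x y => [a||a] [b||b] //= ab nba.
- exists (Fin ((a + b) / 2)); rewrite !lt_leAnge /Order.le /=.
  have {nba} ltab : a < b by rewrite ltNge.
  have [h1 h2] := (midf_lt ltab); rewrite -!ltNge h1 h2 !ltW //.
- by exists (Fin (a + 1)); rewrite !lt_leAnge /Order.le /= ltW ?lt1 // le1.
- by exists Infty; rewrite !lt_leAnge /Order.le /=.
- by exists (Opp (b + 1)); rewrite !lt_leAnge /Order.le /= ltW ?lt1 // le1.
- exists (Opp ((b + a) / 2)); rewrite !lt_leAnge /Order.le /=.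
  have {nba} ltab : b < a by rewrite ltNge.
  have [h1 h2] := (midf_lt ltab); rewrite -!ltNge h1 h2 !ltW //.
Qed.

Lemma ext_unbounded (x : ext R) :
  (exists z, (z < x)%O) /\ (exists z, (x < z)%O).
Proof.
have le1 (a : R) : (a + 1 <= a) = false by apply/negbTE; rewrite -ltNge ltrDl.
have ge1 (a : R) : (a <= a - 1) = false.
  by apply/negbTE; rewrite -ltNge ltrBlDr ltrDl.
have l1 (a : R) : a <= a + 1 by rewrite lerDl.
have g1 (a : R) : a - 1 <= a by rewrite lerBlDr lerDl.
case: x => [a||a]; split.
- by exists (Fin (a - 1)); rewrite lt_leAnge /Order.le /= g1 ge1.
- by exists Infty; rewrite lt_leAnge /Order.le /=.
- by exists (Fin 0); rewrite lt_leAnge /Order.le /=.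
- by exists (Opp 0); rewrite lt_leAnge /Order.le /=.
- by exists Infty; rewrite lt_leAnge /Order.le /=.
- by exists (Opp (a - 1)); rewrite lt_leAnge /Order.le /= g1 ge1.
Qed.

Lemma itv_bounds_dense (l r : itv_bound (ext R)) : (l < r)%O ->
  exists z, z \in Interval l r.
Proof.
case: l r => [[] x|[]] [[] y|[]] //.
- by rewrite bnd_simp => xy; exists x; rewrite itv_boundlr !bnd_simp ?lexx.
- by rewrite bnd_simp => xy; exists x; rewrite itv_boundlr !bnd_simp ?lexx.
- by move=> _; exists x; rewrite itv_boundlr !bnd_simp ?lexx.
- rewrite bnd_simp => /ext_between[z /andP[xz zy]].
  by exists z; rewrite itv_boundlr !bnd_simp xz.
- by rewrite bnd_simp => xy; exists y; rewrite itv_boundlr !bnd_simp ?lexx xy.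
- move=> _; have [_ [z xz]] := ext_unbounded x.
  by exists z; rewrite itv_boundlr !bnd_simp xz.
- move=> _; have [[z zy] _] := ext_unbounded y.
  by exists z; rewrite itv_boundlr !bnd_simp zy.
- by move=> _; exists y; rewrite itv_boundlr !bnd_simp ?lexx.
- by move=> _; exists Infty; rewrite itv_boundlr !bnd_simp.
Qed.

(** The order on [interval] compares bounds, so it could be strictly finer than
    inclusion.  It is not: the extended line is dense and has no extreme
    points, so two distinct bounds are always separated by a point. *)
Lemma point_outside (I J : interval (ext R)) : (exists x, x \in I) ->
  ~~ (I <= J)%O -> exists2 z, z \in I & z \notin J.
Proof.
case: I J => l r [l' r'] [x]; rewrite itv_boundlr => /andP[lx xr].
have lr : (l < r)%O.
  by apply: le_lt_trans lx (lt_le_trans _ xr); rewrite bnd_simp.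
rewrite [X in ~~ X](_ : _ = (l' <= l)%O && (r <= r')%O) //.
rewrite negb_and -!ltNge => /orP[ll'|rr'].
  have /itv_bounds_dense[z] : (l < Order.min l' r)%O by rewrite lt_min ll'.
  rewrite itv_boundlr le_min => /and3P[lz zl' zr]; exists z.
    by rewrite itv_boundlr lz.
  rewrite itv_boundlr negb_and -ltNge; apply/orP; left.
  by apply: lt_le_trans zl'; rewrite bnd_simp.
have /itv_bounds_dense[z] : (Order.max l r' < r)%O by rewrite gt_max lr.
rewrite itv_boundlr ge_max => /andP[/andP[lz r'z] zr]; exists z.
  by rewrite itv_boundlr lz.
rewrite itv_boundlr negb_and -!ltNge; apply/orP; right.
by apply: le_lt_trans r'z _; rewrite bnd_simp.
Qed.

Lemma itv_convex (I : interval (ext R)) x y z :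
  x \in I -> y \in I -> (x <= z <= y)%O -> z \in I.
Proof.
case: I => l r; rewrite !itv_boundlr => /andP[lx _] /andP[_ yr] /andP[xz zy].
by rewrite (le_trans lx) ?bnd_simp // (le_trans _ yr) ?bnd_simp.
Qed.

Lemma maximal_mem (d : Order.disp_t) (T : porderType d) (s : seq T) :
  s != [::] -> exists2 x, x \in s & {in s, forall y, (x <= y)%O -> y = x}.
Proof.
elim: s => // a s IH _.
case: (eqVneq s [::]) IH => [-> _|s0 /(_ isT)[x xs xmax]].
  by exists a; rewrite ?mem_head // => y; rewrite inE => /eqP->.
have [xa|nxa] := boolP (x <= a)%O.
  exists a; rewrite ?mem_head // => y; rewrite inE => /predU1P[->//|ys ay].
  apply/eqP; rewrite eq_le ay andbT.
  by rewrite (xmax y ys (le_trans xa ay)).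
exists x; first by rewrite inE xs orbT.
move=> y; rewrite inE => /predU1P[-> xa|]; last exact: xmax.
by rewrite xa in nxa.
Qed.

(** For each J in B choose a point of I outside J.  The smallest and the largest
    chosen points cannot lie together in any J, which is convex. *)
Lemma maximal_separated (I : interval (ext R)) (B : seq (interval (ext R))) :
  (exists x, x \in I) -> {in B, forall J, ~~ (I <= J)%O} ->
  exists x y, [/\ (x <= y)%O, contains_both x y I &
                  ~~ has (contains_both x y) B].
Proof.
move=> I0; elim: B => [|J B IH] nle.
  by have [x xI] := I0; exists x, x; rewrite /contains_both xI.
have [|x [y [xy /andP[xI yI] nB]]] := IH.
  by move=> K KB; apply: nle; rewrite inE KB orbT.
have [z zI zJ] := point_outside I0 (nle J (mem_head _ _)).
exists (Order.min x z), (Order.max y z); split.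
- by rewrite ge_min le_max xy.
- rewrite /contains_both.
  by case: (leP x z) => _; case: (leP y z) => _; apply/andP.
rewrite /= negb_or; apply/andP; split.
  apply: contra zJ => /andP[mJ MJ]; apply: itv_convex mJ MJ _.
  by rewrite ge_min le_max lexx !orbT.
apply: contra nB => /hasP[K KB /andP[mK MK]]; apply/hasP; exists K => //.
by apply/andP; split; apply: itv_convex mK MK _;
   rewrite ge_min le_max ?lexx ?xy ?orbT.
Qed.

(** A maximal interval I of B ++ B' must occur in both lists.  If it were
    missing from one of them, the two points of [maximal_separated] would be
    counted 0 times there and at least once in the other.  Remove I from both
    lists and repeat. *)
Lemma perm_eq_of_counts (B B' : seq (interval (ext R))) :
  {in B ++ B', forall I, exists x, x \in I} ->
  (forall x y, (x <= y)%O ->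
     count (contains_both x y) B = count (contains_both x y) B') ->
  perm_eq B B'.
Proof.
have mem (C C' : seq (interval (ext R))) I :
    {in C ++ C', forall J, (I <= J)%O -> J = I} ->
    (exists x, x \in I) -> (forall x y, (x <= y)%O ->
      count (contains_both x y) C = count (contains_both x y) C') ->
    I \in C -> I \in C'.
  move=> Imax I0 cnt IC; apply: contraT => nI.
  have [J JC'|x [y [xy xyI]]] := @maximal_separated I C' I0.
    apply: contra nI => IJ; rewrite -(Imax J) // mem_cat JC' orbT //.
  rewrite has_count -cnt // -has_count => /hasPn /(_ I IC).
  by rewrite xyI.
have [n] := ubnP (size B + size B'); elim: n B B' => // n IH B B' sz ne cnt.
case: (eqVneq (B ++ B') [::]) => [|BB0].
  by case: B {sz ne cnt} => //= ->.
have [I IBB Imax] := maximal_mem BB0; have I0 := ne I IBB.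
have Imax' : {in B' ++ B, forall J, (I <= J)%O -> J = I}.
  by move=> J; rewrite mem_cat orbC -mem_cat; apply: Imax.
have IB : I \in B.
  move: IBB; rewrite mem_cat => /orP[//|]; apply: mem Imax' I0 _ => x y xy.
  by rewrite cnt.
have IB' := mem _ _ _ Imax I0 cnt IB.
rewrite (permPl (perm_to_rem IB)) (permPr (perm_to_rem IB')) perm_cons.
apply: IH => [|J|x y xy].
- move: sz; rewrite !size_rem //; case: (B) IB => // a l _ /=.
  rewrite addSn ltnS => /(leq_trans _); apply; rewrite ltnS.
  by rewrite leq_add2l leq_pred.
- by rewrite mem_cat => /orP[] /mem_rem JB; apply: ne; rewrite mem_cat JB ?orbT.
- apply/eqP; rewrite -(eqn_add2l (contains_both x y I)); apply/eqP.
  have := cnt x y xy; rewrite (permP (perm_to_rem IB)) => /= ->.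
  by rewrite (permP (perm_to_rem IB')).
Qed.

Theorem barcode_unique (M : epmodule k R) B B' :
  decomposes M B -> decomposes M B' -> perm_eq B B'.
Proof.
move=> [adm iso] [adm' iso']; apply: perm_eq_of_counts => [I|x y xy].
  by rewrite mem_cat => /orP[/adm[]|/adm'[]].
rewrite -!(@rank_itv_sum _ _ _ xy).
by rewrite -(epm_iso_rank xy iso) (epm_iso_rank xy iso').
Qed.

Lemma barcode_perm (M : epmodule k R) B :
  decomposes M B -> perm_eq (barcode M) B.
Proof.
move=> dec; have bdec : decomposes M (barcode M).
  exact: (@xgetI _ [::] [set C | decomposes M C]%classic B dec).
exact: barcode_unique bdec dec.
Qed.

End BarcodeUniqueness.

(** * Matchings padded by diagonal points *)

Section PaddedMatchings.
Variable R : realType.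
Implicit Types (u v w : R * R) (A B C D E : seq (R * R)) (P : pred (R * R)).

Lemma dist_xx u : dist u u = 0.
Proof. by rewrite /dist !subrr normr0 maxxx. Qed.

Lemma dist_ge0 u v : 0 <= dist u v.
Proof. by rewrite /dist le_max normr_ge0. Qed.

Lemma distC u v : dist u v = dist v u.
Proof. by rewrite /dist distrC [`|u.2 - _|]distrC. Qed.

Lemma dist_triangle v u w : dist u w <= dist u v + dist v w.
Proof.
rewrite /dist ge_max; apply/andP; split.
  apply: le_trans (ler_distD v.1 _ _) _.
  by rewrite lerD // le_max lexx.
apply: le_trans (ler_distD v.2 _ _) _.
by rewrite lerD // le_max lexx orbT.
Qed.

Definition on_diagonal : pred (R * R) := [pred u | u.1 == u.2].

Lemma dist_diag_le u v : on_diagonal v -> dist_diag u <= dist u v.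
Proof.
case: v => a b /eqP /= <-; apply: ge_inf; last by exists a.
by exists 0 => _ [z _ <-]; exact: dist_ge0.
Qed.

(** A partial matching becomes a bijection once points satisfying P are added
    on both sides.  With P the diagonal this describes partial matchings whose
    unmatched points are close to the diagonal, and with P empty it describes
    perfect matchings; unlike partial matchings, bijections compose without a
    case distinction. *)
Definition padded_matched P (c : R) A B : Prop :=
  exists (m : seq ((R * R) * (R * R))) D E,
    [/\ all P D, all P E, perm_eq (A ++ D) (unzip1 m),
        perm_eq (B ++ E) (unzip2 m) &
        forall x, x \in m -> dist x.1 x.2 <= c].

Lemma padded_matched_perm P c A A' B B' : perm_eq A A' -> perm_eq B B' ->
  padded_matched P c A' B' -> padded_matched P c A B.
Proof.
move=> AA BB [m [D [E [PD PE mA mB md]]]]; exists m, D, E; split=> //.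
  by apply: perm_trans mA; rewrite perm_cat2r.
by apply: perm_trans mB; rewrite perm_cat2r.
Qed.

Lemma perm_unzip1 (m : seq ((R * R) * (R * R))) s :
  perm_eq s (unzip1 m) -> exists2 m', perm_eq m' m & unzip1 m' = s.
Proof.
move=> /(perm_iotaP (0, 0)); rewrite size_map => -[Is pI ->].
pose x0 : (R * R) * (R * R) := ((0, 0), (0, 0)).
exists [seq nth x0 m i | i <- Is].
  by rewrite -[X in perm_eq _ X](mkseq_nth x0) perm_map.
rewrite /unzip1 -map_comp; apply/eq_in_map => i.
by rewrite (perm_mem pI) mem_iota add0n /= => im; rewrite (nth_map x0).
Qed.

(** Padding points of either matching are matched with themselves, at cost 0,
    in the other one; then the two bijections meet in the same multiset. *)
Lemma padded_matched_trans P c c' A B C : 0 <= c -> 0 <= c' ->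
  padded_matched P c A B -> padded_matched P c' B C ->
  padded_matched P (c + c') A C.
Proof.
move=> c0 c0' [m [D [E [PD PE mA mB md]]]] [m' [D' [E' [PD' PE' mB' mC md']]]].
pose dg (s : seq (R * R)) := [seq (u, u) | u <- s].
have dg1 s : unzip1 (dg s) = s by rewrite /unzip1 -map_comp map_id.
have dg2 s : unzip2 (dg s) = s by rewrite /unzip2 -map_comp map_id.
have cat1 (s t : seq ((R * R) * (R * R))) :
    unzip1 (s ++ t) = unzip1 s ++ unzip1 t.
  exact: map_cat.
have cat2 (s t : seq ((R * R) * (R * R))) :
    unzip2 (s ++ t) = unzip2 s ++ unzip2 t.
  exact: map_cat.
have dgP s x : x \in dg s -> dist x.1 x.2 = 0.
  by case/mapP=> v _ ->; exact: dist_xx.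
have nd x : x \in m ++ dg D' -> dist x.1 x.2 <= c.
  by rewrite mem_cat => /orP[/md//|/dgP->].
have nd' x : x \in m' ++ dg E -> dist x.1 x.2 <= c'.
  by rewrite mem_cat => /orP[/md'//|/dgP->].
have [|n' pn' n'1] := @perm_unzip1 (m' ++ dg E) (unzip2 (m ++ dg D')).
  rewrite cat1 cat2 dg1 dg2.
  have pB := perm_cat mB (perm_refl D'); have pB' := perm_cat mB' (perm_refl E).
  rewrite perm_sym in pB; apply: perm_trans pB (perm_trans _ pB').
  by rewrite -!catA perm_cat2l perm_catC.
set n := m ++ dg D' in nd n'1.
have sz : size (unzip1 n) = size (unzip2 n').
  by rewrite !size_map -(size_map fst n') -/(unzip1 n') n'1 size_map.
exists (zip (unzip1 n) (unzip2 n')), (D ++ D'), (E' ++ E).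
split; rewrite ?all_cat ?PD ?PD' ?PE ?PE' //.
- rewrite unzip1_zip ?sz // /n cat1 dg1.
  by rewrite catA perm_cat2r.
- rewrite unzip2_zip ?sz //.
  apply: perm_trans (_ : perm_eq _ (unzip2 (m' ++ dg E))) _.
    by rewrite cat2 dg2 catA perm_cat2r.
  by rewrite perm_map // perm_sym.
move=> w /(nthP ((0, 0), (0, 0)))[i].
rewrite size_zip -sz minnn => iz <-; rewrite nth_zip //= .
have iz1 : (i < size n)%N by rewrite size_map in iz.
have iz2 : (i < size n')%N by rewrite sz size_map in iz.
pose x0 : (R * R) * (R * R) := ((0, 0), (0, 0)).
rewrite (nth_map x0) // (nth_map x0) //.
apply: le_trans (dist_triangle (nth x0 n i).2 _ _) _.
have e : (nth x0 n i).2 = (nth x0 n' i).1.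
  rewrite -(nth_map x0 (0, 0) snd) // -(nth_map x0 (0, 0) fst) //.
  by rewrite -/(unzip1 n') n'1.
rewrite lerD //; first by apply: nd; rewrite mem_nth.
by rewrite e; apply: nd'; rewrite -(perm_mem pn') mem_nth.
Qed.

(** The points of A may lie on the diagonal themselves, so they cannot be told
    apart from the padding D.  It suffices to count all of them as unmatched:
    off the diagonal, the points f x are exactly those of A. *)
Lemma perm_split_diagonal (m : seq ((R * R) * (R * R))) (f h : _ -> R * R) A D :
  all on_diagonal D -> perm_eq (A ++ D) [seq f x | x <- m] ->
  perm_eq A
    ([seq f x | x <- m & ~~ on_diagonal (f x) && ~~ on_diagonal (h x)] ++
     (seq.filter on_diagonal A ++
      [seq f x | x <- m & ~~ on_diagonal (f x) && on_diagonal (h x)])).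
Proof.
move=> PD pA.
apply: perm_trans (_ : perm_eq _
  (seq.filter on_diagonal A ++ seq.filter (predC on_diagonal) A)) _.
  by rewrite perm_sym perm_filterC.
rewrite perm_sym perm_catCA perm_cat2l -map_cat perm_sym.
have -> : [seq x <- A | predC on_diagonal x] =
    [seq x <- A ++ D | predC on_diagonal x].
  rewrite filter_cat [X in _ ++ X](_ : _ = [::]) ?cats0 //.
  by apply/eqP; rewrite -(negbK (_ == _)) -has_filter has_predC PD.
apply: perm_trans (perm_filter _ pA) _; rewrite filter_map perm_map //.
rewrite perm_sym; set Q := preim f _.
pose N x := ~~ on_diagonal (h x).
apply: perm_trans (_ : perm_eq _ (seq.filter N (seq.filter Q m) ++
   seq.filter (predC N) (seq.filter Q m))) _; last first.
  by rewrite perm_filterC.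
have eq_perm (s t : seq ((R * R) * (R * R))) : s = t -> perm_eq s t by move->.
rewrite -!filter_predI; apply: perm_cat; apply: eq_perm; apply: eq_filter => x.
  by rewrite /= andbC.
by rewrite /= negbK andbC.
Qed.

Lemma padded_partial_matched c A B : 0 <= c ->
  padded_matched on_diagonal c A B -> partial_matched c A B.
Proof.
move=> c0 [m [D [E [PD PE mA mB md]]]].
have pA := perm_split_diagonal snd PD mA.
have pB := perm_split_diagonal fst PE mB.
set A0 := (X in perm_eq A (_ ++ X)) in pA.
set B0 := (X in perm_eq B (_ ++ X)) in pB.
exists [seq x <- m | ~~ on_diagonal x.1 && ~~ on_diagonal x.2], A0, B0; split.
- split; first exact: pA.
  have nn x : ~~ on_diagonal x.1 && ~~ on_diagonal x.2 =
              ~~ on_diagonal x.2 && ~~ on_diagonal x.1 by rewrite andbC.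
  by rewrite (eq_filter nn).
- by move=> u; rewrite mem_filter => /andP[_]; exact: md.
- move=> u; rewrite mem_cat mem_filter => /orP[/andP[du _]|/mapP[x]].
    by apply: le_trans (dist_diag_le u du) _; rewrite dist_xx.
  rewrite mem_filter => /andP[/andP[_ d2] xm] ->.
  exact: le_trans (dist_diag_le _ d2) (md _ xm).
- move=> u; rewrite mem_cat mem_filter => /orP[/andP[du _]|/mapP[x]].
    by apply: le_trans (dist_diag_le u du) _; rewrite dist_xx.
  rewrite mem_filter => /andP[/andP[_ d2] xm] ->.
  apply: le_trans (dist_diag_le _ d2) _; rewrite distC; exact: md.
Qed.

Lemma padded_perfect_matched c A B :
  padded_matched pred0 c A B -> perfect_matched c A B.
Proof.
move=> [m [D [E [PD PE mA mB md]]]]; exists m; split=> //.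
have nil s : all (@pred0 (R * R)) s -> s = [::] by case: s.
move: mA mB; rewrite (nil _ PD) (nil _ PE).
by rewrite /partial_matching !cats0.
Qed.

End PaddedMatchings.

(** * Homology of pairs of hyperedge sets *)

Section Homology.
Variable k : fieldType.

Lemma homology_map_bij (C D : complex k) (f : forall p, 'Hom(C p, D p)) p :
  chain_map f -> (forall p, bijective (f p)) -> bijective (homology_map f p).
Proof.
move=> cf bij.
have k0 q : lker (f q) == 0%VS by apply/lker0P; exact: bij_inj.
have fK q : cancel (f q) (f q)^-1%VF := lker0_lfunK (k0 q).
have fVK q : cancel (f q)^-1%VF (f q).
  by move=> v; have [g _ gK] := bij q; rewrite -(gK v) fK.
pose g q := ((f q)^-1)%VF.
have cg : chain_map g.
  move=> q x; rewrite -[LHS]fK /g !(fVK, cf).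
  by rewrite -[in LHS](fVK _ x) -cf !fK.
exists (homology_map g p) => x.
  rewrite -comp_lfunE -(@homology_map_comp _ _ _ _ f g (fun=> \1%VF)) //.
    by rewrite homology_map_id ?id_lfunE // => q y; rewrite id_lfunE.
  by move=> q y; rewrite id_lfunE fK.
rewrite -comp_lfunE -(@homology_map_comp _ _ _ _ g f (fun=> \1%VF)) //.
  by rewrite homology_map_id ?id_lfunE // => q y; rewrite id_lfunE.
by move=> q y; rewrite id_lfunE fVK.
Qed.

Lemma homology_map_square (C D D' E : complex k) (f : forall p, 'Hom(C p, D p))
    (g : forall p, 'Hom(D p, E p)) (f' : forall p, 'Hom(C p, D' p))
    (g' : forall p, 'Hom(D' p, E p)) p v :
  chain_map f -> chain_map g -> chain_map f' -> chain_map g' ->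
  (forall p x, g p (f p x) = g' p (f' p x)) ->
  homology_map g p (homology_map f p v) =
  homology_map g' p (homology_map f' p v).
Proof.
move=> cf cg cf' cg' eq.
rewrite -!comp_lfunE -(@homology_map_comp _ _ _ _ f' g'
  (fun q => (g q \o f q)%VF)) //; last by move=> q x; rewrite comp_lfunE.
rewrite -(@homology_map_comp _ _ _ _ f g (fun q => (g q \o f q)%VF)) //.
by move=> q x; rewrite comp_lfunE.
Qed.

Lemma homology_zero (C : complex k) p :
  (forall v : C p, v = 0) -> (fullv : {vspace homology C p}) = 0%VS.
Proof.
move=> C0; apply/eqP; rewrite -subv0; apply/subvP; apply: quot_ind => x _.
rewrite (_ : x = 0) ?linear0 ?mem0v //.
by apply: val_inj; rewrite /= [LHS]C0 [RHS]C0.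
Qed.

Variable C : complex k.
Implicit Types D E : forall p, {vspace C p}.

Lemma supcomplex_rel_map_id D E p v : supcomplex_rel_map D E D E p v = v.
Proof.
elim/quot_ind: v => v.
by rewrite [LHS](supcomplex_rel_mapE (E := E)) // supcomplex_incl_id.
Qed.

Lemma supcomplex_rel_map_comp D E D' E' D'' E'' p v :
  (forall q, (D q <= D' q)%VS) -> (forall q, (E q <= E' q)%VS) ->
  (forall q, (D' q <= D'' q)%VS) -> (forall q, (E' q <= E'' q)%VS) ->
  supcomplex_rel_map D E D'' E'' p v =
  supcomplex_rel_map D' E' D'' E'' p (supcomplex_rel_map D E D' E' p v).
Proof.
move=> d e d' e'; elim/quot_ind: v => v.
rewrite [LHS](supcomplex_rel_mapE (E := E) (E' := E'')); first last.
- by move=> q; apply: subv_trans (e q) (e' q).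
- by move=> q; apply: subv_trans (d q) (d' q).
rewrite [X in _ = _ X](supcomplex_rel_mapE (E := E)) //.
by rewrite supcomplex_rel_mapE // -supcomplex_incl_comp.
Qed.

Lemma supcomplex_rel_eq0 D E p (v : supcomplex_rel D E p) :
  (forall q, (D q <= E q)%VS) -> v = 0.
Proof.
move=> DE; elim/quot_ind: v => v; apply/eqP.
rewrite -memv_ker lker_quot_pi mem_vs_in.
exact: subvP (supSS p DE) _ (subvsP v).
Qed.

Lemma supcomplex_proj_bij D E p : (forall q, E q = 0%VS) ->
  bijective (supcomplex_proj D E p).
Proof.
move=> E0; have S0 : vs_in (supS D p) (supS E p) = 0%VS.
  apply/eqP; rewrite -subv0; apply/subvP=> v; rewrite mem_vs_in.
  by rewrite /supS !E0 limg0 addv0 !memv0 => /eqP v0; apply/eqP/val_inj.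
have k0 : lker (supcomplex_proj D E p) == 0%VS by rewrite lker_quot_pi S0.
exists (supcomplex_proj D E p)^-1%VF; first exact: lker0_lfunK.
by move=> v; rewrite limg_lfunVK // limg_quot_pi memvf.
Qed.

End Homology.

Section PairModule.
Variables (k : fieldType) (R : realType) (V : finType) (H : {set {set V}}).
Variable p : nat.

(** A pair (A, B) stands for the relative homology of A modulo B.  Absolute
    homology is the case where B is empty, which gives one functor for both
    halves of the extended line, and identifies the level at infinity with the
    last absolute and the first relative one. *)
Definition edge_pair := ({set {set V}} * {set {set V}})%type.
Definition pair_le (u v : edge_pair) := (u.1 \subset v.1) && (u.2 \subset v.2).

Local Notation chains H' := (hyper_chains k H H').
Implicit Types u v w : edge_pair.

Definition pair_complex (u : edge_pair) : complex k :=
  supcomplex_rel (chains u.1) (chains u.2).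

Definition pair_homology (u : edge_pair) : vectType k :=
  homology (pair_complex u) p.

Definition pair_map (u v : edge_pair) q :
    'Hom(pair_complex u q, pair_complex v q) :=
  supcomplex_rel_map (chains u.1) (chains u.2) (chains v.1) (chains v.2) q.

Definition pair_hmap (u v : edge_pair) :
    'Hom(pair_homology u, pair_homology v) :=
  homology_map (pair_map u v) p.

Lemma pair_leE u v : pair_le u v ->
  (forall q, (chains u.1 q <= chains v.1 q)%VS) /\
  (forall q, (chains u.2 q <= chains v.2 q)%VS).
Proof. by case/andP=> s1 s2; split=> q; exact: hyper_chainsS. Qed.

Lemma pair_map_chain u v : pair_le u v -> chain_map (pair_map u v).
Proof. by case/pair_leE=> s1 s2; exact: supcomplex_rel_map_chain. Qed.

Lemma pair_hmap_id u : pair_hmap u u = \1%VF.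
Proof. by apply: homology_map_id => q x; exact: supcomplex_rel_map_id. Qed.

Lemma pair_hmap_comp u v w : pair_le u v -> pair_le v w ->
  pair_hmap u w = (pair_hmap v w \o pair_hmap u v)%VF.
Proof.
move=> uv vw; apply: homology_map_comp; try exact: pair_map_chain.
move=> q x; have [s1 s2] := pair_leE uv; have [t1 t2] := pair_leE vw.
exact: supcomplex_rel_map_comp.
Qed.

Lemma pair_homology_eq0 u : u.1 \subset u.2 ->
  (fullv : {vspace pair_homology u}) = 0%VS.
Proof.
move=> s; apply: homology_zero => v; apply: supcomplex_rel_eq0 => q.
exact: hyper_chainsS.
Qed.

Section Pullback.
Variable P : ext R -> edge_pair.
Hypothesis P_mono : forall x y, (x <= y)%O -> pair_le (P x) (P y).

Fact pull_id x (xx : (x <= x)%O) : pair_hmap (P x) (P x) = \1%VF.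
Proof. exact: pair_hmap_id. Qed.

Fact pull_comp x y z (xy : (x <= y)%O) (yz : (y <= z)%O) (xz : (x <= z)%O) :
  pair_hmap (P x) (P z) = (pair_hmap (P y) (P z) \o pair_hmap (P x) (P y))%VF.
Proof. by apply: pair_hmap_comp; apply: P_mono. Qed.

Definition pair_module : epmodule k R :=
  {| pobj := fun x => pair_homology (P x);
     Defs.pmap := fun x y _ => pair_hmap (P x) (P y);
     pmap_id := pull_id; pmap_comp := pull_comp |}.

End Pullback.

Definition level_pair (f : hyperedge H -> R) (x : ext R) : edge_pair :=
  match x with
  | Fin a => (sublevel f a, finset.set0)
  | Infty => (H, finset.set0)
  | Opp b => (H, superlevel f b)
  end.

Lemma chains0 q : chains finset.set0 q = 0%VS.
Proof.
apply/eqP; rewrite -subv0; apply/span_subvP => v /mapP[s].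
by rewrite mem_enum !inE.
Qed.

Definition to_level_pair f x :
    'Hom(homology (level_complex k f x) p, pair_homology (level_pair f x)) :=
  match x with
  | Fin a => homology_map
      (supcomplex_proj (chains (sublevel f a)) (chains finset.set0)) p
  | Infty => homology_map
      (supcomplex_proj (chains H) (chains finset.set0)) p
  | Opp b => \1%VF
  end.

Lemma to_level_pair_bij f x : bijective (to_level_pair f x).
Proof.
have bij D : bijective
    (homology_map (supcomplex_proj D (chains finset.set0)) p).
  apply: homology_map_bij; first exact: supcomplex_proj_chain.
  by move=> q; apply: supcomplex_proj_bij => r; exact: chains0.
case: x => [a||b]; [exact: bij | exact: bij |].
- by exists id => v; rewrite id_lfunE.
Qed.

Lemma pair_hmap_proj (A B E : {set {set V}})
    (v : homology (supcomplex (chains A)) p) : A \subset B ->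
  homology_map (supcomplex_proj (chains B) (chains E)) p
    (homology_map (supcomplex_incl (chains A) (chains B)) p v) =
  pair_hmap (A, finset.set0) (B, E)
    (homology_map (supcomplex_proj (chains A) (chains finset.set0)) p v).
Proof.
move=> AB; have le : pair_le (A, finset.set0) (B, E).
  by rewrite /pair_le AB finset.sub0set.
have [sAB s0E] := pair_leE le.
apply: (@homology_map_square _ (supcomplex (chains A)) (supcomplex (chains B))
  (pair_complex (A, finset.set0)) (pair_complex (B, E))
  (supcomplex_incl _ _) (supcomplex_proj _ _)
  (supcomplex_proj _ _) (pair_map (A, finset.set0) (B, E))).
- exact: supcomplex_incl_chain.
- exact: supcomplex_proj_chain.
- exact: supcomplex_proj_chain.
- exact: pair_map_chain.
- by move=> q w; rewrite [RHS]supcomplex_rel_mapE.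
Qed.

Lemma pair_hmap_proj_incl (A B E : {set {set V}})
    (v : homology (supcomplex (chains A)) p) : A \subset B ->
  homology_map (fun q => supcomplex_proj (chains B) (chains E) q \o
                         supcomplex_incl (chains A) (chains B) q)%VF p v =
  pair_hmap (A, finset.set0) (B, E)
    (homology_map (supcomplex_proj (chains A) (chains finset.set0)) p v).
Proof.
move=> AB; rewrite -pair_hmap_proj // -comp_lfunE.
have -> // := @homology_map_comp _ _ _ (supcomplex_rel (chains B) (chains E))
  (supcomplex_incl (chains A) (chains B)) (supcomplex_proj _ _)
  (fun q => supcomplex_proj (chains B) (chains E) q \o
            supcomplex_incl (chains A) (chains B) q)%VF.
- by apply: supcomplex_incl_chain => q; rewrite hyper_chainsS.
- exact: supcomplex_proj_chain.
- by move=> q w; rewrite comp_lfunE.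
Qed.

Lemma pair_hmap_proj_proj (B E : {set {set V}})
    (v : homology (supcomplex (chains B)) p) :
  homology_map (supcomplex_proj (chains B) (chains E)) p v =
  pair_hmap (B, finset.set0) (B, E)
    (homology_map (supcomplex_proj (chains B) (chains finset.set0)) p v).
Proof.
rewrite -pair_hmap_proj // [X in _ = _ (fun_of_lfun X _)]homology_map_id.
  by rewrite id_lfunE.
by move=> q w; exact: supcomplex_incl_id.
Qed.

Lemma to_level_pair_natural f x y
    (v : homology (level_complex k f x) p) : (x <= y)%O ->
  to_level_pair f y (homology_map (level_map k f x y) p v) =
  pair_hmap (level_pair f x) (level_pair f y) (to_level_pair f x v).
Proof.
case: x v => [a||a] v; case: y => [b||b] xy.
- exact (@pair_hmap_proj (sublevel f a) (sublevel f b) finset.set0 v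
    (sublevelS f xy)).
- exact (@pair_hmap_proj (sublevel f a) H finset.set0 v (sublevel_sub f a)).
- exact: etrans (id_lfunE _) (pair_hmap_proj_incl _ _ (sublevel_sub f a)).
- by case: (notF xy).
- exact: (@pair_hmap_proj H H finset.set0 v (subxx _)).
- exact: etrans (id_lfunE _) (pair_hmap_proj_proj _ _).
- by case: (notF xy).
- by case: (notF xy).
- exact: etrans (id_lfunE _) (congr1 _ (esym (id_lfunE _))).
Qed.

(** A parametrization of the levels by any P equal to [level_pair f] is allowed,
    so that the pullback can be taken through a chain. *)
Theorem hyper_module_pullback f (P : ext R -> edge_pair)
    (P_mono : forall x y, (x <= y)%O -> pair_le (P x) (P y)) :
  (forall x, P x = level_pair f x) ->
  epm_iso (hyper_module k f p) (pair_module P_mono).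
Proof.
move=> /funext PE; move: P_mono; rewrite PE => P_mono.
exists (to_level_pair f); split; first exact: to_level_pair_bij.
by move=> x y xy v; exact: to_level_pair_natural.
Qed.

End PairModule.

(** * Functions that are monotone along a common list of hyperedges *)

Lemma take_drop_count (T : Type) (r : rel T) (P : pred T) (s : seq T) :
  transitive r -> (forall x y, r x y -> P y -> P x) -> sorted r s ->
  take (count P s) s = [seq x <- s | P x] /\
  drop (count P s) s = [seq x <- s | ~~ P x].
Proof.
move=> tr down; elim: s => //= x s IH xs.
have [IH1 IH2] := IH (path_sorted xs).
case: ifP => Px; first by rewrite add1n /= IH1.
have nP : all (predC P) s.
  apply: sub_all (order_path_min tr xs) => y rxy /=.
  by apply: contraFN Px; exact: down.
have c0 : count P s = 0%N by apply/eqP; rewrite eqn0Ngt -has_count -all_predC.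
rewrite c0 take0 drop0 /= in IH1 IH2 *; split => //.
by congr (_ :: _).
Qed.

Section SortedHyperedges.
Variables (R : realType) (V : finType) (H : {set {set V}}).
Variable l : seq (hyperedge H).
Hypothesis all_l : forall s, s \in l.
Implicit Types f g : hyperedge H -> R.

Definition sorted_by f := sorted (relpre f <=%R) l.

Definition edge_set (s : seq (hyperedge H)) : {set {set V}} :=
  [set val x | x in s]%SET.

(** In the first half, m <= size l, the second set is empty; in the second half
    the first set is everything. *)
Definition edge_chain (m : nat) : edge_pair V :=
  (edge_set (take m l), edge_set (drop (size l + size l - m) l)).

(** The points of the extended line where the level pair of f changes, in
    increasing order. *)
Definition events f : seq (ext R) :=
  [seq Fin (f s) | s <- l] ++ rev [seq Opp (f s) | s <- l].

Definition event_rank f (x : ext R) : nat :=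
  count (fun y => (y <= x)%O) (events f).

Lemma edge_set_mono s t : {subset s <= t} -> edge_set s \subset edge_set t.
Proof.
move=> st; apply/fintype.subsetP => _ /imsetP[x xs ->].
by apply: imset_f; exact: st.
Qed.

Lemma edge_set_all : edge_set l = H.
Proof.
apply/finset.setP => e; apply/imsetP/idP => [[x _ ->]|eH]; first exact: valP.
by exists (Sub e eH) => //; rewrite ?all_l ?SubK.
Qed.

Lemma edge_set_nil : edge_set [::] = finset.set0.
Proof. by apply/finset.setP => e; rewrite inE; apply/imsetP => -[]. Qed.

Lemma edge_set_filter (P : pred (hyperedge H)) :
  edge_set [seq s <- l | P s] = [set val s | s : hyperedge H & P s]%SET.
Proof.
apply/finset.setP => e; apply/imsetP/imsetP => -[x xP ->]; exists x => //.
  by move: xP; rewrite mem_filter inE => /andP[].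
by move: xP; rewrite mem_filter inE all_l andbT.
Qed.

Lemma edge_chain_mono m n : (m <= n)%N -> pair_le (edge_chain m) (edge_chain n).
Proof.
move=> mn; apply/andP; split; apply: edge_set_mono => s.
  by rewrite -(take_takel l mn) => /mem_take.
have dd : (size l + size l - n <= size l + size l - m)%N by rewrite leq_sub2l.
by rewrite -(subnK dd) -drop_drop => /mem_drop.
Qed.

Lemma event_rank_mono f x y :
  (x <= y)%O -> (event_rank f x <= event_rank f y)%N.
Proof. by move=> xy; apply: sub_count => z /= zx; exact: le_trans xy. Qed.

Lemma event_rankE f x : event_rank f x =
  match x with
  | Fin a => count (fun s => (f s <= a)%R) l
  | Infty => size l
  | Opp b => (size l + count (fun s => (b <= f s)%R) l)%N
  end.
Proof.
rewrite /event_rank count_cat count_rev !count_map.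
case: x => [a||b]; rewrite -?[in RHS](count_predT l).
- rewrite -[RHS]addn0 -[in RHS](count_pred0 l).
  by congr (_ + _)%N; apply: eq_count.
- rewrite -[RHS]addn0 -[in RHS](count_pred0 l).
  by congr (_ + _)%N; apply: eq_count.
- by congr (_ + _)%N; apply: eq_count.
Qed.

(** The sets f <= a are initial segments of l, and the sets f >= b are final
    segments. *)
Lemma level_pair_edge_chain f x :
  sorted_by f -> level_pair f x = edge_chain (event_rank f x).
Proof.
move=> fs.
have tr : transitive (relpre f <=%R) by move=> a b c; exact: le_trans.
rewrite event_rankE /edge_chain; case: x => [a||b] /=.
- have [|tk _] := take_drop_count (P := fun s => f s <= a) tr _ fs.
    by move=> x y /= xy ya; exact: le_trans xy ya.
  rewrite tk edge_set_filter drop_oversize ?edge_set_nil //.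
  by rewrite -addnBA ?leq_addr // count_size.
- by rewrite take_size edge_set_all addnK drop_size edge_set_nil.
- rewrite take_oversize ?leq_addr // edge_set_all subnDl.
  have -> : (size l - count (fun s => (b <= f s)%R) l =
             count (fun s => (f s < b)%R) l)%N.
    rewrite -(count_predC (fun s => b <= f s) l) addKn.
    by apply: eq_count => s; rewrite /= ltNge.
  have [|_ dr] := take_drop_count (P := fun s => f s < b) tr _ fs.
    by move=> x y /= xy yb; exact: le_lt_trans xy yb.
  rewrite dr (eq_filter (a2 := fun s => b <= f s)) ?edge_set_filter //.
  by move=> s; rewrite -leNgt.
Qed.

Lemma size_events f : size (events f) = (size l + size l)%N.
Proof. by rewrite size_cat size_rev !size_map. Qed.

Lemma events_sorted f : sorted_by f -> sorted <=%O (events f).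
Proof.
move=> fs; rewrite sorted_pairwise ?pairwise_cat -?sorted_pairwise;
  try exact: le_trans.
apply/and3P; split.
- by apply/allrelP => x y /mapP[s _ ->]; rewrite mem_rev => /mapP[t _ ->].
- by rewrite sorted_map.
- by rewrite rev_sorted sorted_map.
Qed.

(** Indices start at 1, since the pair of index 0 precedes all events. *)
Definition event f (i : nat) : ext R := nth Infty (events f) i.-1.

(** The events and the rank are adjoint, so that the preimage of an interval of
    indices is an interval between events. *)
Lemma event_le f i x : sorted_by f -> (0 < i <= size l + size l)%N ->
  (event f i <= x)%O = (i <= event_rank f x)%N.
Proof.
move=> fs /andP[i0 isz]; have es := events_sorted fs.
have ip : (i.-1 < size (events f))%N by rewrite size_events prednK.
rewrite -[in RHS](prednK i0); apply/idP/idP => [ix|]; last exact: nth_count_le.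
rewrite ltnNge; apply: contraTN ix => ci; rewrite -ltNge.
by apply: nth_count_gt => //; rewrite ci.
Qed.

Definition bar_itv f (b : nat * nat) : interval (ext R) :=
  Interval (BSide true (event f b.1)) (BSide true (event f b.2)).

Lemma mem_bar_itv f b x : sorted_by f ->
  (0 < b.1 < b.2)%N -> (b.2 <= size l + size l)%N ->
  (x \in bar_itv f b) = (b.1 <= event_rank f x < b.2)%N.
Proof.
move=> fs /andP[b0 b12] b2.
rewrite itv_boundlr !bnd_simp ltNge !event_le //.
- by rewrite -ltnNge.
- by rewrite b2 (leq_trans _ b12).
- by rewrite b0 (leq_trans (ltnW b12)).
Qed.

Lemma event_not_infty f i : (i.-1 < size l + size l)%N -> event f i <> Infty.
Proof.
rewrite -(size_events f) => /(mem_nth Infty) + e; rewrite -/(event f i) e.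
by rewrite mem_cat mem_rev => /orP[] /mapP[].
Qed.

(** A bar whose end events coincide has an empty preimage and must be
    discarded, because an interval of a decomposition is nonempty. *)
Definition essential f (b : nat * nat) : bool := (event f b.1 < event f b.2)%O.

(** The list T is chosen before f: it describes the chain of pairs, not the
    function.  All births are at least 1 and all deaths at most twice the size
    of l, because the first and the last pair have equal members, hence
    vanishing homology; so every end of a bar is an event, and never infinity. *)
Theorem common_bars (k : fieldType) (p : nat) :
  exists T : seq (nat * nat),
    (forall b, b \in T -> (0 < b.1 < b.2)%N && (b.2 <= size l + size l)%N) /\
    forall f, sorted_by f ->
      decomposes (hyper_module k f p)
                 [seq bar_itv f b | b <- T & essential f b].
Proof.
pose X m := pair_homology k H p (edge_chain m).
pose F m n : 'Hom(X m, X n) := pair_hmap k H p (edge_chain m) (edge_chain n).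
have F_id m x : F m m x = x by rewrite /F pair_hmap_id id_lfunE.
have F_comp a b c x : (a <= b)%N -> (b <= c)%N -> F b c (F a b x) = F a c x.
  move=> ab bc; rewrite /F.
  rewrite (pair_hmap_comp k H p (edge_chain_mono ab) (edge_chain_mono bc)).
  by rewrite [RHS]comp_lfunE.
have [|||s [sB sP]] := @chain_decomposition k X F F_id F_comp
    (size l + size l) (fun=> fullv).
- by move=> *; exact: subvf.
- by apply: pair_homology_eq0; apply: edge_set_mono => x; rewrite take0.
- move=> m lm; apply: pair_homology_eq0; apply: edge_set_mono => x /mem_take.
  by move: lm; rewrite -subn_eq0 => /eqP ->; rewrite drop0.
exists [seq (birth b, death b) | b <- s]; split.
  by move=> _ /mapP[b /sP[bP _] ->].
move=> f fs; split.
  move=> I /mapP[c + ->]; rewrite mem_filter => /andP[ess /mapP[b bs cE]].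
  have [/andP[/andP[b0 b12] b2] _] := sP b bs.
  split; first by exists (event f c.1); rewrite itv_boundlr !bnd_simp ?lexx.
  rewrite cE; move=> [[d [_ e]]|[d [_ e]]]; apply: (event_not_infty _ e) => /=.
    by rewrite prednK // ltnW // (leq_trans b12).
  by rewrite prednK // (leq_trans _ b12).
have P_mono x y : (x <= y)%O ->
    pair_le (edge_chain (event_rank f x)) (edge_chain (event_rank f y)).
  by move=> xy; apply/edge_chain_mono/event_rank_mono.
have iso := hyper_module_pullback (f := f) k p P_mono
  (fun x => esym (level_pair_edge_chain x fs)).
apply: epm_iso_trans iso _.
rewrite filter_map -map_comp.
apply: (interval_sum_of_bases (M := pair_module k H p P_mono)
  (I := fun b : bar X => bar_itv f (birth b, death b))
  (e := fun b x => bar_elt F b (event_rank f x))).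
- move=> b x y xy; rewrite mem_filter => /andP[_ bs].
  have [/andP[b12 b2] bd] := sP b bs.
  rewrite !mem_bar_itv // => xI.
  exact: (bar_elt_transport F_comp bd xI (event_rank_mono f xy)).
- move=> x; have := sB (event_rank f x); rewrite -filter_predI.
  congr (basis_of _ (map _ _)); apply: eq_in_filter => b bs.
  have [/andP[b12 b2] _] := sP b bs.
  rewrite /= mem_bar_itv // /alive; case: andP => //= -[bx xd].
  apply/esym; rewrite /essential; apply: (@le_lt_trans _ _ x).
    rewrite event_le //=; case/andP: b12 => -> /= /ltnW b12.
    exact: leq_trans b12 b2.
  rewrite ltNge event_le ?b2 -?ltnNge //=.
  by case/andP: b12 => b0 b12; rewrite (leq_trans _ b12).
Qed.

End SortedHyperedges.

(** * Stability *)

(** Matches the bars of one list with themselves.  The predicates a and a'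
    select the bars that are nonempty for either function; a bar that is
    dropped on one side contributes a padding point there. *)
Lemma padded_matched_pmap (R : realType) (T : eqType) (P : pred (R * R)) (c : R)
    (s : seq T) (a a' : pred T) (q q' : T -> option (R * R)) :
  (forall b, b \in s -> match q b, q' b with
     | Some u, Some u' =>
         [/\ dist u u' <= c, a b || P u & a' b || P u']
     | None, None => True
     | _, _ => False
     end) ->
  padded_matched P c (seq.pmap q [seq b <- s | a b])
                     (seq.pmap q' [seq b <- s | a' b]).
Proof.
elim: s => [|b s IH] qq; first by exists [::], [::], [::].
have [|m [D [E [PD PE mA mB md]]]] := IH.
  by move=> b' b's; apply: qq; rewrite inE b's orbT.
have /= := qq b (mem_head _ _).
case qb: (q b) => [u|]; case q'b: (q' b) => [u'|] //; last first.
  by move=> _; exists m, D, E; split=> //; case: ifP => //=; rewrite ?qb ?q'b.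
case=> du au au'.
have mid (A : seq (R * R)) w D' : perm_eq (A ++ w :: D') (w :: (A ++ D')).
  by rewrite perm_catC /= perm_cons perm_catC.
exists ((u, u') :: m), (if a b then D else u :: D),
  (if a' b then E else u' :: E); split.
- by case: ifP au => //= _ ->.
- by case: ifP au' => //= _ ->.
- case: ifP => _ /=; rewrite ?qb /= ?perm_cons //.
  by apply: perm_trans (mid _ _ _) _; rewrite perm_cons.
- case: ifP => _ /=; rewrite ?q'b /= ?perm_cons //.
  by apply: perm_trans (mid _ _ _) _; rewrite perm_cons.
- by move=> w; rewrite inE => /predU1P[->|/md].
Qed.

Section Stability.
Variables (k : fieldType) (R : realType) (V : finType) (H : {set {set V}}).
Variable p : nat.
Implicit Types f g h : hyperedge H -> R.

(** The form of [matched] in which distances add up under composition. *)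
Definition diagrams_close (c : R) f g : Prop :=
  let M := hyper_module k f p in let N := hyper_module k g p in
  [/\ decomposable M /\ decomposable N,
      padded_matched (@on_diagonal R) c (Ord M) (Ord N),
      padded_matched (@on_diagonal R) c (Rel M) (Rel N) &
      padded_matched pred0 c (Ext M) (Ext N)].

Lemma diagrams_close_trans c c' f g h : 0 <= c -> 0 <= c' ->
  diagrams_close c f g -> diagrams_close c' g h -> diagrams_close (c + c') f h.
Proof.
move=> c0 c0'; case=> [[dM _] o r e]; case=> [[_ dP] o' r' e']; split.
- by split.
- exact: padded_matched_trans c0 c0' o o'.
- exact: padded_matched_trans c0 c0' r r'.
- exact: padded_matched_trans c0 c0' e e'.
Qed.

Section CommonOrder.
Variable l : seq (hyperedge H).
Hypothesis all_l : forall s, s \in l.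

(** Both the hyperedge s and the half of the line depend on the index only.  This
    is what makes the bars of two functions comparable. *)
Lemma event_hyperedge i : (i.-1 < size l + size l)%N ->
  exists s, forall f,
    event l f i = if (i.-1 < size l)%N then Fin (f s) else Opp (f s).
Proof.
case: (posnP (size l)) => [-> //|l0 isz].
have x0 : hyperedge H by case: l l0 => // x.
exists (nth x0 (l ++ rev l) i.-1) => f.
rewrite /event /events !nth_cat -map_rev !size_map.
by case: ltnP => il; rewrite (nth_map x0) // size_rev ltn_subLR.
Qed.

Lemma event_mono f i j : sorted_by l f -> (i <= j)%N ->
  (j.-1 < size l + size l)%N -> (event l f i <= event l f j)%O.
Proof.
move=> fs ij jsz; have ij1 : (i.-1 <= j.-1)%N by rewrite -!subn1 leq_sub2r.
apply: (sorted_leq_nth le_trans le_refl); rewrite ?inE ?size_events //.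
- exact: events_sorted.
- exact: leq_ltn_trans jsz.
Qed.

(** For a bar across infinity the ends are always in strict order, whatever the
    values are, so no such bar is ever discarded; this is why the matching of
    the extended parts is perfect. *)
Lemma bars_close (c : R) f g : sorted_by l f -> sorted_by l g ->
  (forall s, `|f s - g s| <= c) -> diagrams_close c f g.
Proof.
move=> fs gs fgc; have [T [TP dec]] := common_bars R all_l k p.
have decf := dec f fs; have decg := dec g gs.
have distc s t : dist (f s, f t) (g s, g t) <= c by rewrite /dist ge_max !fgc.
have reduce (q : interval (ext R) -> option (R * R)) P : (forall b, b \in T ->
     match q (bar_itv l f b), q (bar_itv l g b) with
     | Some u, Some u' =>
         [/\ dist u u' <= c, essential l f b || P u & essential l g b || P u']
     | None, None => True
     | _, _ => False
     end) ->
    padded_matched P c (seq.pmap q (barcode (hyper_module k f p)))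
                       (seq.pmap q (barcode (hyper_module k g p))).
  move=> qP; apply: padded_matched_perm.
  - exact: perm_pmap (barcode_perm decf).
  - exact: perm_pmap (barcode_perm decg).
  have pmapE h : seq.pmap q [seq bar_itv l h b | b <- T & essential l h b] =
      seq.pmap (fun b => q (bar_itv l h b)) [seq b <- T | essential l h b].
    by elim: [seq b <- T | _] => //= b s ->.
  by rewrite !pmapE; exact: padded_matched_pmap.
have bar_eventE b : b \in T -> exists s t, forall h, sorted_by l h ->
    [/\ event l h b.1 = if (b.1.-1 < size l)%N then Fin (h s) else Opp (h s),
        event l h b.2 = if (b.2.-1 < size l)%N then Fin (h t) else Opp (h t) &
        (event l h b.1 <= event l h b.2)%O].
  case/TP/andP=> /andP[b0 b12] b2.
  have i2 : (b.2.-1 < size l + size l)%N by rewrite prednK // (leq_trans _ b12).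
  have i1 : (b.1.-1 < size l + size l)%N.
    by rewrite prednK // (leq_trans (ltnW b12)).
  have [s sE] := event_hyperedge i1; have [t tE] := event_hyperedge i2.
  by exists s, t => h hs; split=> //; apply: event_mono hs (ltnW b12) i2.
have le_diag (u v : R) :
    (Fin u <= Fin v)%O -> (Fin u < Fin v)%O || on_diagonal (u, v).
  by rewrite le_eqVlt => /predU1P[[->]|->] //; apply/orP; right; exact: eqxx.
have ge_diag (u v : R) :
    (Opp u <= Opp v)%O -> (Opp u < Opp v)%O || on_diagonal (u, v).
  by rewrite le_eqVlt => /predU1P[[->]|->] //; apply/orP; right; exact: eqxx.
split; first by split; [exists [seq bar_itv l f b | b <- T & essential l f b]
                      | exists [seq bar_itv l g b | b <- T & essential l g b]].
- apply: reduce => b /bar_eventE[s [t E]]; rewrite /bar_itv /essential.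
  have [-> -> lef] := E f fs; have [-> -> leg] := E g gs.
  move: lef leg; have [-> -> _] := E f fs; have [-> -> _] := E g gs.
  case: ifP; case: ifP => _ _ lef leg //; split=> //.
    exact: le_diag lef.
  exact: le_diag leg.
- apply: reduce => b /bar_eventE[s [t E]]; rewrite /bar_itv /essential.
  have [-> -> lef] := E f fs; have [-> -> leg] := E g gs.
  move: lef leg; have [-> -> _] := E f fs; have [-> -> _] := E g gs.
  case: ifP; case: ifP => _ _ lef leg //; split=> //.
    exact: ge_diag lef.
  exact: ge_diag leg.
- apply: reduce => b /bar_eventE[s [t E]]; rewrite /bar_itv /essential.
  have [-> -> lef] := E f fs; have [-> -> leg] := E g gs.
  by case: ifP; case: ifP => //= _ _; rewrite lt_leAnge /Order.le /=.
Qed.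

End CommonOrder.


(** Along a list sorted by f + g both functions are nondecreasing: if f strictly
    decreases at a step, then g does not increase, and f + g strictly
    decreases. *)
Lemma compatible_close (c : R) f g : (forall s t, f s < f t -> g s <= g t) ->
  (forall s, `|f s - g s| <= c) -> diagrams_close c f g.
Proof.
move=> fg; pose r (s t : hyperedge H) := f s + g s <= f t + g t.
have srt : sorted r (sort r (enum {: hyperedge H})).
  by apply: sort_sorted => s t; exact: le_total.
apply: (bars_close (l := sort r (enum {: hyperedge H}))).
- by move=> s; rewrite mem_sort mem_enum.
- apply: sub_sorted srt => s t; rewrite /r /= !leNgt; apply: contraNN => ts.
  by rewrite ltr_leD // fg.
- apply: sub_sorted srt => s t; rewrite /r /= !leNgt; apply: contraNN => ts.
  by rewrite ler_ltD // leNgt; apply/negP => /fg; rewrite leNgt ts.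
Qed.

Definition inversions f g : {set hyperedge H * hyperedge H} :=
  [set st | (f st.1 < f st.2) && (g st.2 < g st.1)]%SET.

(** The time x at which the two entries of st have equal values under
    (1 - x) f + x g. *)
Definition crossing_time f g (st : hyperedge H * hyperedge H) : R :=
  (f st.2 - f st.1) / ((f st.2 - f st.1) + (g st.1 - g st.2)).

(** Up to the first crossing time of an inversion no order is reversed, and at
    that time one inversion is resolved while no new one appears. *)
Lemma close_of_sup_le (c : R) f g : 0 <= c -> (forall s, `|f s - g s| <= c) ->
  diagrams_close c f g.
Proof.
have [n] := ubnP #|inversions f g|.
elim: n => // n IH in c f g * => invn c0 fgc.
case: (set_0Vmem (inversions f g)) => [inv0|[st0 st0I]].
  apply: compatible_close => // s t fst; rewrite leNgt; apply/negP => gts.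
  have : (s, t) \in inversions f g by rewrite inE /= fst gts.
  by rewrite inv0 inE.
case: (arg_minP (crossing_time f g) st0I) => -[s t] stI tmin.
set x := crossing_time f g (s, t) in tmin.
have stI' : (s, t) \in inversions f g := stI.
move: (stI'); rewrite inE /= => /andP[fst gts].
have d0 : 0 < (f t - f s) + (g s - g t) by rewrite addr_gt0 ?subr_gt0.
have x0 : 0 < x by rewrite divr_gt0 ?subr_gt0.
have x1 : x < 1 by rewrite ltr_pdivrMr // mul1r ltrDl subr_gt0.
pose h a := f a + x * (g a - f a).
have hE a b : h b - h a = (1 - x) * (f b - f a) + x * (g b - g a).
  by rewrite /h; ring.
have hst : h s = h t.
  apply/eqP; rewrite eq_sym -subr_eq0; apply/eqP.
  rewrite (_ : h t - h s = (f t - f s) - x * ((f t - f s) + (g s - g t))).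
    by rewrite /x /crossing_time /= divfK ?subrr // gt_eqF.
  by rewrite /h; ring.
have x1' : 0 <= 1 - x by rewrite subr_ge0 ltW.
have -> : c = x * c + (1 - x) * c by ring.
have xc0 : 0 <= x * c := mulr_ge0 (ltW x0) c0.
have xc1 : 0 <= (1 - x) * c := mulr_ge0 x1' c0.
apply: (diagrams_close_trans (g := h)) => //.
- apply: compatible_close => [a b fab|a].
    rewrite -subr_ge0; have [gab|gba] := leP (g a) (g b).
      by rewrite hE addr_ge0 // mulr_ge0 ?subr_ge0 // ltW.
    have dab : 0 < (f b - f a) + (g a - g b) by rewrite addr_gt0 ?subr_gt0.
    have abI : (a, b) \in inversions f g by rewrite inE /= fab gba.
    have := tmin _ abI; rewrite /crossing_time /= ler_pdivlMr // -subr_ge0.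
    congr (0 <= _).
    by rewrite /h; ring.
  rewrite (_ : f a - h a = x * (f a - g a)); last by rewrite /h; ring.
  by rewrite normrM gtr0_norm // ler_wpM2l // ltW.
- apply: IH => // [|a]; last first.
    rewrite (_ : h a - g a = (1 - x) * (f a - g a)); last by rewrite /h; ring.
    by rewrite normrM ger0_norm // ler_wpM2l.
  apply: leq_trans (_ : #|inversions f g| <= n)%N; last by rewrite -ltnS.
  apply: proper_card; apply/properP; split.
    apply/fintype.subsetP => -[a b]; rewrite !inE /= => /andP[hab gba].
    rewrite gba andbT.
    rewrite ltNge; apply/negP => fba; move: hab; rewrite ltNge -subr_ge0 hE.
    by rewrite addr_ge0 // mulr_ge0 ?subr_ge0 // ltW.
  by exists (s, t) => //; rewrite inE /= hst ltxx.
Qed.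

End Stability.

Theorem theorem6p10 (k : fieldType) (R : realType) (V : finType)
    (H : {set {set V}}) (hH : is_hypergraph H) (f g : hyperedge H -> R)
    (p : nat) :
  (bottleneck (hyper_module k f p) (hyper_module k g p)
     <= (sup_dist f g)%:E)%E.
Proof.
have ub : has_ubound (range (fun s => `|f s - g s|)).
  exists (\sum_(s : hyperedge H) `|f s - g s|) => _ [s _ <-].
  by rewrite (bigD1 s) //= lerDl sumr_ge0.
have fgc s : `|f s - g s| <= sup_dist f g by apply: ub_le_sup => //; exists s.
have c0 : 0 <= sup_dist f g.
  (* without hyperedges the supremum is that of the empty set, which is 0 *)
  have [[s _]|none] := pselect (exists s : hyperedge H, True).
    exact: le_trans (normr_ge0 _) (fgc s).
  have r0 : range (fun s => `|f s - g s|) = classical_sets.set0.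
    by rewrite -subset0 => z [s _ _]; apply: none; exists s.
  by rewrite /sup_dist r0 sup0.
(* the infimum is over positive numbers, while the distance may be 0 *)
apply/lee_addgt0Pr => e e0; apply: ereal_inf_lbound.
exists (sup_dist f g + e) => //; split; first by rewrite ltr_wpDl.
have ce0 : 0 <= sup_dist f g + e by rewrite addr_ge0 // ltW.
have [|dec o r ex] := close_of_sup_le k p ce0 (f := f) (g := g).
  by move=> s; apply: le_trans (fgc s) _; rewrite lerDl ltW.
split=> //; [exact: padded_partial_matched | exact: padded_partial_matched |].
exact: padded_perfect_matched.
Qed.
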